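(* Let $n \ge 3$ be an integer and let $G = P_n \Box P_3$. Then $$S_{SC}(G) = [1,3n-3] \setminus \{2,3,5,7\},$$ where $[1,3n-3]$ denotes the set of integers $r$ with $1\le r\le 3n-3$.
   Context: $P_n$ denotes the path on $n$ vertices and $G\Box H$ the cartesian product of graphs. An orientation $D$ of a graph is strong if for every ordered pair of vertices $u,v$ there is a directed path from $u$ to $v$. A $uv$-geodesic in $D$ is a shortest directed path from $u$ to $v$. A nonempty set $S\subseteq V(D)$ is convex in $D$ if for every $u,v\in S$, every vertex lying on a $uv$-geodesic or on a $vu$-geodesic belongs to $S$. The convexity number $\mathrm{con}(D)$ is the maximum cardinality of a convex set of $D$ different from $V(D)$. The strong convexity spectrum of a graph $G$ is $S_{SC}(G)=\{\mathrm{con}(D) : D \text{ is a strong orientation of } G\}$. *)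

(* Defs.v *)
From mathcomp Require Import all_boot.
From mathcomp Require Import boolp classical_sets.

Set Implicit Arguments.
Unset Strict Implicit.
Unset Printing Implicit Defensive.

(* Graphs and digraphs on a finite vertex type T are given by their adjacency
   relation [rel T]; a simple graph is a symmetric irreflexive relation. *)

Definition path_graph (n : nat) : rel 'I_n :=
  fun i j => (i.+1 == j :> nat) || (j.+1 == i :> nat).
Arguments path_graph n _ _ : clear implicits.

Definition cart_prod (T1 T2 : finType) (e1 : rel T1) (e2 : rel T2) :
    rel (T1 * T2) :=
  fun x y => ((x.1 == y.1) && e2 x.2 y.2) || ((x.2 == y.2) && e1 x.1 y.1).

Lemma path_graph_sym n : symmetric (path_graph n).
Proof. by move=> i j; rewrite /path_graph orbC. Qed.

Lemma path_graph_irr n : irreflexive (path_graph n).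
Proof. by move=> i; rewrite /path_graph orbb -[X in _ == X]addn0 -addn1 eqn_add2l. Qed.

Lemma cart_prod_sym (T1 T2 : finType) (e1 : rel T1) (e2 : rel T2) :
  symmetric e1 -> symmetric e2 -> symmetric (cart_prod e1 e2).
Proof.
move=> s1 s2 x y; rewrite /cart_prod s1 s2.
by rewrite [x.1 == _]eq_sym [x.2 == _]eq_sym.
Qed.

Lemma cart_prod_irr (T1 T2 : finType) (e1 : rel T1) (e2 : rel T2) :
  irreflexive e1 -> irreflexive e2 -> irreflexive (cart_prod e1 e2).
Proof. by move=> i1 i2 x; rewrite /cart_prod i1 i2 !andbF. Qed.

Section Digraph.
Variable T : finType.
Implicit Types (e D : rel T) (S : {set T}) (u v w : T) (p q : seq T).

Definition orientation e D : Prop :=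
  forall u v, (D u v || D v u = e u v) /\ ~~ (D u v && D v u).

(* As in the library, [p] lists the vertices following [u], so the vertices of
   the path are those of [u :: p] and its length is [size p]. *)
Definition dipath D u v p : bool :=
  [&& path D u p, last u p == v & uniq (u :: p)].

Definition strong D : Prop := forall u v, exists p, dipath D u v p.

Definition geodesic D u v p : Prop :=
  dipath D u v p /\ forall q, dipath D u v q -> size p <= size q.

Definition convex D S : Prop :=
  S != finset.set0 /\
  forall u v, u \in S -> v \in S ->
  forall w, (exists2 p, geodesic D u v p & w \in u :: p) \/
            (exists2 p, geodesic D v u p & w \in v :: p) ->
  w \in S.

(* When #|T| >= 2, a singleton is a proper convex set, so the maximum ranges
   over a nonempty family. *)
Definition con D : nat :=
  \max_(S : {set T} | `[< convex D S >] && (S != finset.setT)) #|S|.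

Definition strong_convexity_spectrum e : set nat :=
  [set con D | D in [set D : rel T | orientation e D /\ strong D]]%classic.

End Digraph.

(* Main.v *)
Require Import Defs.
From mathcomp Require Import all_boot.
From mathcomp Require Import zify.
From mathcomp Require Import boolp classical_sets.

Set Implicit Arguments.
Unset Strict Implicit.
Unset Printing Implicit Defensive.

(* Exclusions. In a convex set with at least two vertices every vertex has an
   in-neighbour and an out-neighbour in the set, hence two neighbours in the
   grid. This leaves only the sizes 4, 6 and 7 below 8, and at size 7 the set S
   is two squares sharing a vertex, whose complement is disconnected; adding a
   component of the complement to S keeps it convex, so S was not maximum. If
   the complement of a convex set has one or two vertices, a path of length 2 or
   3 through it is a geodesic between two vertices of the set, because the grid
   is bipartite and every edge extends to a straight path.

   Realizations. If the last column is c -> b -> a with d(b,c) = 3 and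
   d(a,c) = 4, then a column a' -> b' -> c' attached by a -> a', b -> b' and
   c' -> c changes no old distance, and the new column has the same shape once
   all arcs are reversed. If the maximum convex set contains the end column, it
   grows by 3; if no proper convex set contains b and c, the convexity number
   does not change. All pairs (n, r) follow from eleven small orientations. *)

(** * Distance functions *)

Section Distance.
Variable T : finType.
Implicit Types (D : rel T) (d : T -> T -> nat) (S X : {set T}) (u v w : T).

(** A local characterization of the directed distance: zero exactly on the diagonal, dropping by at
    most one along every arc and by exactly one along some arc. It mentions no paths, so it can be
    verified on a finite table and across an extension. *)
Definition is_dist D d : Prop :=
  [/\ forall u v, d u v = 0 <-> u = v,
      forall u v w, D u w -> d u v <= (d w v).+1 &
      forall u v, u <> v -> exists2 w, D u w & d u v = (d w v).+1].

(** Convexity without nonemptiness; geodesics in both directions are covered because [u] and [v]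
    range over all ordered pairs of [S]. *)
Definition geo_closed d S : Prop :=
  forall u v w, u \in S -> v \in S -> d u w + d w v = d u v -> w \in S.

(** The values 3 and 4 are the lengths of the routes from [b] and from [a] to [c] through the column
    to be attached, which is thus never a shortcut. *)
Definition end_col D d a b c : Prop :=
  [/\ D c b, D b a, d c a = 2, d b c = 3 & d a c = 4].

Definition converse D : rel T := fun u v => D v u.
Definition converse_dist d := fun u v => d v u.

Lemma closed_converse d S : geo_closed (converse_dist d) S <-> geo_closed d S.
Proof.
by split=> cS u v w uS vS; rewrite addnC => /(cS v u w vS uS).
Qed.

Section Theory.
Variables (D : rel T) (d : T -> T -> nat).
Hypothesis dD : is_dist D d.

Lemma dist0 u : d u u = 0.
Proof. by case: dD => [d0 _ _]; apply/d0. Qed.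

Lemma dist_eq0 u v : d u v = 0 -> u = v.
Proof. by case: dD => [d0 _ _] /d0. Qed.

Lemma dist_step u v w : D u w -> d u v <= (d w v).+1.
Proof. by case: dD => [_ + _]; apply. Qed.

Lemma dist_first u v : u <> v -> exists2 w, D u w & d u v = (d w v).+1.
Proof. by case: dD => [_ _ +]; apply. Qed.

Lemma dist_arc u v : D u v -> u <> v -> d u v = 1.
Proof.
move=> uv nuv; have := dist_step v uv; rewrite dist0.
by case: (d u v) (@dist_eq0 u v) => [/(_ erefl)|[]].
Qed.

Lemma dist_triangle v u w : d u w <= d u v + d v w.
Proof.
move: {2}(d u v) (erefl (d u v)) => k; elim: k u => [|k IH] x dx.
  by rewrite (dist_eq0 dx) leq_addl.
have nxv : x <> v by move=> xv; rewrite xv dist0 in dx.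
have [y xy dy] := dist_first nxv.
have := dist_step w xy; have := IH y; lia.
Qed.

Lemma dist_last u v : u <> v -> exists2 w, D w v & d u v = (d u w).+1.
Proof.
move=> nuv; move: {2}(d u v) (erefl (d u v)) => k;
elim: k u nuv => [|k IH] x nxv dx.
  by case: (nxv (dist_eq0 dx)).
have [y xy dy] := dist_first nxv.
have [yv|/eqP nyv] := eqVneq y v.
  by exists x => //; [rewrite -yv | rewrite dy yv !dist0].
have [z zv dz] := IH y nyv ltac:(lia).
exists z => //; have := dist_step z xy; have := dist_triangle z x v.
have -> : d z v = 1; last lia.
apply: dist_arc => // zv'; move: dz; rewrite zv'; lia.
Qed.

Lemma is_dist_converse : is_dist (converse D) (converse_dist d).
Proof.
split=> [u v|u v w|u v nuv]; rewrite /converse /converse_dist.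
- by split=> [/dist_eq0|->]; last exact: dist0.
- move=> wu; have [->|/eqP nwu] := eqVneq u w; first by lia.
  by have := dist_triangle w v u; rewrite (dist_arc wu); [lia | apply/nesym].
- by apply: dist_last; apply/nesym.
Qed.

Lemma dist_path u v p : path D u p -> last u p = v -> d u v <= size p.
Proof.
elim: p u => [|x p IH] u /= => [_ ->|/andP[ux xp] lx]; first by rewrite dist0.
by have := dist_step v ux; have := IH x xp lx; lia.
Qed.

Lemma dist_pathE u v :
  exists p, [/\ path D u p, last u p = v & size p = d u v].
Proof.
move: {2}(d u v) (erefl (d u v)) => k; elim: k u => [|k IH] x dx.
  by exists [::]; rewrite /= (dist_eq0 dx) dist0.
have nxv : x <> v by move=> xv; rewrite xv dist0 in dx.
have [y xy dy] := dist_first nxv.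
have [|p [yp lp sp]] := IH y; first lia.
by exists (y :: p); rewrite /= xy yp lp sp; split => //; lia.
Qed.

Lemma shortest_uniq u v p :
  path D u p -> last u p = v -> size p = d u v -> uniq (u :: p).
Proof.
move=> up lp sp; case: (shortenP up) lp => p' up' uniqp' sub lp'.
apply: leq_size_uniq uniqp' _ _.
  move=> x; rewrite !inE => /orP[->//|/sub ->]; exact: orbT.
by rewrite /= ltnS sp; apply: dist_path.
Qed.

Lemma geodesicP u v p :
  geodesic D u v p <-> [/\ path D u p, last u p = v & size p = d u v].
Proof.
split=> [[/and3P[up /eqP lp uniqp] minp]|[up lp sp]].
  split=> //; apply/eqP; rewrite eqn_leq (dist_path up lp) andbT.
  have [q [uq lq sq]] := dist_pathE u v.
  by rewrite -sq minp // /dipath uq lq eqxx (shortest_uniq uq lq sq).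
split; first by rewrite /dipath up lp eqxx (shortest_uniq up lp sp).
by move=> q /and3P[uq /eqP lq _]; rewrite sp; apply: dist_path.
Qed.

Lemma on_geodesicP u v w :
  (exists2 p, geodesic D u v p & w \in u :: p) <-> d u w + d w v = d u v.
Proof.
split=> [[p /geodesicP[up lp sp]]|duwv].
  move=> wp; have := dist_triangle w u v; have := wp.
  rewrite inE => /orP[/eqP->|{}wp]; first by rewrite dist0.
  case/splitPr: wp up lp sp => p1 p2.
  rewrite cat_path last_cat size_cat /= => /and3P[up1 wl wp2] l2 sz.
  have {}sz : size (p1 : seq T) + (size (p2 : seq T)).+1 = d u v by [].
  have := dist_path wp2 l2; have : d u w <= (size (p1 : seq T)).+1; last by lia.
  rewrite -(size_rcons p1 w); apply: dist_path; last by rewrite last_rcons.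
  by rewrite rcons_path up1.
have [p [up lp sp]] := dist_pathE u w; have [q [wq lq sq]] := dist_pathE w v.
exists (p ++ q).
  apply/geodesicP; rewrite cat_path up lp wq last_cat lp lq size_cat.
  by split=> //; lia.
by rewrite -cat_cons mem_cat -{1}lp mem_last.
Qed.

Lemma convexP S : convex D S <-> S != finset.set0 /\ geo_closed d S.
Proof.
split=> -[S0 cS]; split=> // u v.
  by move=> w uS vS duv; apply: (cS u v uS vS); left; apply/on_geodesicP.
move=> uS vS w [] /on_geodesicP; exact: cS.
Qed.

Lemma dist_strong : strong D.
Proof.
move=> u v; have [p [up lp sp]] := dist_pathE u v.
by exists p; rewrite /dipath up lp eqxx (shortest_uniq up lp sp).
Qed.

Lemma closed_out S u v : geo_closed d S -> u \in S -> v \in S -> u <> v ->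
  exists2 w, w \in S & D u w.
Proof.
move=> cS uS vS nuv; have [w uw dw] := dist_first nuv; exists w => //.
apply: (cS u v) => //; rewrite (dist_arc uw) ?dw // => uw'.
by move: dw; rewrite -uw'; lia.
Qed.

(** A geodesic from [u] to [v] stays in [S], and some arc of it leaves [A]. *)
Lemma closed_exit S (A : pred T) u v : geo_closed d S ->
  u \in S -> v \in S -> A u -> ~~ A v ->
  exists x y, [/\ x \in S, y \in S, D x y, A x & ~~ A y].
Proof.
move=> cS + vS + nAv.
move: {2}(d u v) (erefl (d u v)) => k; elim: k u => [|k IH] u duv uS Au.
  by rewrite (dist_eq0 duv) (negPf nAv) in Au.
have nuv : u <> v by move=> e; rewrite e (negPf nAv) in Au.
have [w uw dw] := dist_first nuv.
have wS : w \in S.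
  have nuw : u <> w by move=> e; move: dw; rewrite e; lia.
  by apply: (cS u v) => //; rewrite dw (dist_arc uw nuw).
have [Aw|nAw] := boolP (A w); last by exists u, w.
by apply: (IH w) => //; lia.
Qed.

(** Without an arc from [u] to [v] their distance is 2, so the path through [w] is a geodesic. *)
Lemma closed_path2 S u w v : geo_closed d S -> u \in S -> v \in S ->
  D u w -> D w v -> u <> v -> ~~ D u v -> w \in S.
Proof.
move=> cS uS vS uw wv nuv nDuv; apply: (cS u v) => //.
have [z uz dz] := dist_first nuv.
have d2 : 2 <= d u v.
  rewrite dz ltnS lt0n; apply/eqP => /dist_eq0 zv.
  by rewrite -zv uz in nDuv.
have := dist_path (p := [:: w; v]) (u := u) (v := v) _ erefl.
have := dist_path (p := [:: w]) (u := u) (v := w) _ erefl.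
have := dist_path (p := [:: v]) (u := w) (v := v) _ erefl.
have := dist_triangle w u v; rewrite /= uw wv; lia.
Qed.

End Theory.

Lemma strong_dist D : strong D -> exists d, is_dist D d.
Proof.
move=> sD.
have ex u v : exists k, [exists p : k.-tuple T, path D u p && (last u p == v)].
  have [p /and3P[up lp _]] := sD u v; exists (size p).
  by apply/existsP; exists (in_tuple p); rewrite /= up.
pose d u v := ex_minn (ex u v).
have dP u v : exists p, [/\ path D u p, last u p = v & size p = d u v].
  rewrite /d; case: ex_minnP => m /existsP[p /andP[up /eqP lp]] _.
  by exists p; rewrite size_tuple.
have dle u p : path D u p -> d u (last u p) <= size p.
  rewrite /d => up; case: ex_minnP => m _; apply.
  by apply/existsP; exists (in_tuple p); rewrite /= up eqxx.
exists d; split=> [u v|u v w uw|u v nuv].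
- split=> [d0|->]; last by have := dle v [::] isT; rewrite leqn0 => /eqP.
  by have [[|x p] [_ //= _]] := dP u v; rewrite d0.
- have [p [wp <- <-]] := dP w v; apply: (dle u (w :: p)); by rewrite /= uw.
- have [[|w p] /= [up lp sp]] := dP u v; first by case: nuv.
  case/andP: up => uw wp; exists w => //.
  have := dle w p wp; rewrite lp.
  have [q [wq lq sq]] := dP w v.
  have := dle u (w :: q); rewrite /= uw wq lq => /(_ isT); lia.
Qed.

(* A geodesic leaving [~: R] enters [R] through [S] and comes back through
   [S]. *)
Lemma closed_component D d S (R : {set T}) : is_dist D d -> geo_closed d S ->
  [disjoint S & R] ->
  (forall u v, u \notin S :|: R -> v \in R -> ~~ D u v && ~~ D v u) ->
  geo_closed d (~: R).
Proof.
move=> dD cS disj sep.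
(* Some geodesic from outside [R] to a vertex of [R] meets [S]. The digraph is arbitrary because the
   claim is used for [D] and for its converse. *)
have cross D' d' u w : is_dist D' d' ->
    (forall u v, u \notin S :|: R -> v \in R -> ~~ D' u v) ->
    u \notin R -> w \in R -> exists2 s, s \in S & d' u s + d' s w = d' u w.
  move=> dD' sep' uR wR.
  move: {2}(d' u w) (erefl (d' u w)) => k; elim: k u uR => [|k IH] x xR dx.
    by rewrite (dist_eq0 dD' dx) wR in xR.
  have [xS|xS] := boolP (x \in S); first by exists x => //; rewrite (dist0 dD').
  have nxw : x <> w by move=> e; rewrite e wR in xR.
  have [y xy dy] := dist_first dD' nxw.
  have yR : y \notin R.
    apply: contraL xy => yR; apply: sep' => //.
    by rewrite !inE negb_or xS xR.
  have [|s sS ds] := IH y yR; first lia.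
  exists s => //; have := dist_step dD' s xy.
  have := dist_triangle dD' s x w; lia.
move=> u v w; rewrite !finset.in_setC => uR vR duv; apply/negP => wR.
have [s sS ds] := cross D d u w dD
  (fun _ _ a b => proj1 (andP (sep _ _ a b))) uR wR.
have [t tS dt] := cross _ _ v w (is_dist_converse dD)
  (fun _ _ a b => proj2 (andP (sep _ _ a b))) vR wR.
rewrite /converse_dist in dt.
(* The stretch from [s] through [w] to [t] of a geodesic from [u] to [v] is itself a geodesic, with
   both ends in [S]. *)
have /(disjointFr disj)/negP[] : w \in S by apply: (cS s t) => //;
  have := dist_triangle dD w s t; have := dist_triangle dD s u t;
  have := dist_triangle dD t u v; lia.
by [].
Qed.

End Distance.

(** * Attaching a column *)

Section Extension.
Variable T : finType.
Implicit Types (D : rel T) (d : T -> T -> nat) (S X : {set T}) (a b c : T).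

(* The new vertices [None], [Some None] and [Some (Some None)] are attached to
   [a], [b] and [c] respectively. *)
Definition ext_vertex := option (option (option T)).

Definition old (x : T) : ext_vertex := Some (Some (Some x)).

Variables (D : rel T) (d : T -> T -> nat) (a b c : T).

Definition ext_rel : rel ext_vertex := fun u v =>
  match u, v with
  | Some (Some (Some x)), Some (Some (Some y)) => D x y
  | Some (Some (Some x)), None => x == a
  | Some (Some (Some x)), Some None => x == b
  | Some (Some None), Some (Some (Some y)) => y == c
  | None, Some None | Some None, Some (Some None) => true
  | _, _ => false
  end.

(** The new column is entered only from [a] or [b], whence the minimum, and left only towards [c].
    The values 5, 4 and 3 are the lengths of the returns inside the column through [c], [b] and,
    when the target is [None], [a]. *)
Definition ext_dist (u v : ext_vertex) : nat :=
  match u, v with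
  | Some (Some (Some x)), Some (Some (Some y)) => d x y
  | Some (Some (Some x)), None => (d x a).+1
  | Some (Some (Some x)), Some None => (minn (d x b) (d x a).+1).+1
  | Some (Some (Some x)), Some (Some None) => (minn (d x b) (d x a).+1).+2
  | None, Some (Some (Some y)) => d c y + 3
  | Some None, Some (Some (Some y)) => d c y + 2
  | Some (Some None), Some (Some (Some y)) => d c y + 1
  | None, Some None | Some None, Some (Some None) => 1
  | None, Some (Some None) => 2
  | Some None, None => 5
  | Some (Some None), None => 4
  | Some (Some None), Some None => 3
  | None, None | Some None, Some None | Some (Some None), Some (Some None) => 0
  end.

Hypotheses (dD : is_dist D d) (eabc : end_col D d a b c).

Let tri := dist_triangle dD.
Let d0 := dist0 dD.

Lemma end_col_dist :
  [/\ d c a = 2, d b c = 3, d a c = 4, d b a = 1 & d c b = 1].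
Proof.
case: eabc => cb ba ca bc ac; split=> //; apply: (dist_arc dD) => // e.
  by move: ac bc; rewrite e => ->.
by move: bc; rewrite e d0.
Qed.

Lemma ext_dist_step u v w :
  ext_rel u w -> ext_dist u v <= (ext_dist w v).+1.
Proof.
have [ca bc ac ba cb] := end_col_dist.
have step x y z : D x y -> d x z <= (d y z).+1 by exact: (dist_step dD).
have tac := tri c a; have tbc := tri c b.
case: v => [[[v|]|]|]; case: u w => [[[u|]|]|] [[[w|]|]|] //=;
  try (move/eqP=> ->); rewrite ?d0 ?ca ?cb; try lia.
all: try by [exact: step | move: (tac v); lia | move: (tbc v); lia].
all: try by move=> uw; move: (step _ _ a uw) (step _ _ b uw); lia.
Qed.

Lemma ext_dist_first u v : u <> v ->
  exists2 w, ext_rel u w & ext_dist u v = (ext_dist w v).+1.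
Proof.
have [ca bc ac ba cb] := end_col_dist.
(* Towards the last two new vertices an old vertex heads for [a] if that is strictly shorter, and
   for [b] otherwise. *)
have far x : (d x a).+1 < d x b -> x <> a ->
    exists2 w : ext_vertex, ext_rel (old x) w &
      forall y, y = Some None \/ y = Some (Some None) ->
                ext_dist (old x) y = (ext_dist w y).+1.
  move=> lt nxa; have [w xw dw] := dist_first dD nxa.
  exists (old w) => // y yE; have := dist_step dD b xw.
  by case: yE => -> /=; lia.
have near x : d x b <= (d x a).+1 -> x <> b ->
    exists2 w : ext_vertex, ext_rel (old x) w &
      forall y, y = Some None \/ y = Some (Some None) ->
                ext_dist (old x) y = (ext_dist w y).+1.
  move=> le nxb; have [w xw dw] := dist_first dD nxb.
  exists (old w) => // y yE; have := dist_step dD a xw.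
  by case: yE => -> /=; lia.
have to_new x : exists2 w : ext_vertex, ext_rel (old x) w &
      forall y, y = Some None \/ y = Some (Some None) ->
                ext_dist (old x) y = (ext_dist w y).+1.
  have [->|/eqP nxb] := eqVneq x b.
    by exists (Some None) => [/=|y [->|->] /=]; rewrite ?eqxx ?d0 //; lia.
  have [le|lt] := leqP (d x b) (d x a).+1; first exact: near.
  have [->|/eqP nxa] := eqVneq x a; last exact: far.
  exists None => [/=|y [->|->] /=]; rewrite ?eqxx ?d0 //.
    have : d a b <> 0; last lia.
    by move/(dist_eq0 dD) => e; move: ba; rewrite -e d0.
  have : d a b <> 0; last lia.
  by move/(dist_eq0 dD) => e; move: ba; rewrite -e d0.
case: u => [[[u|]|]|] ne.
+ case: v ne => [[[v|]|]|] ne.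
  * have [|w uw dw] := @dist_first _ _ _ dD u v.
      by move=> e; apply: ne; rewrite e.
    by exists (old w).
  * have [w uw dw] := to_new u; exists w => //; apply: dw; by right.
  * have [w uw dw] := to_new u; exists w => //; apply: dw; by left.
  * have [->|/eqP nua] := eqVneq u a.
      by exists None; rewrite /= ?eqxx ?d0.
    have [w uw dw] := dist_first dD nua; exists (old w) => //=.
    by rewrite dw.
+ exists (old c); first by rewrite /= eqxx.
  by case: v ne => [[[v|]|]|] //= _; lia.
+ exists (Some (Some None)) => //.
  by case: v ne => [[[v|]|]|] //= _; lia.
+ exists (Some None) => //.
  by case: v ne => [[[v|]|]|] //= _; lia.
Qed.

Lemma ext_is_dist : is_dist ext_rel ext_dist.
Proof.
split; [|exact: ext_dist_step|exact: ext_dist_first].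
move=> [[[u|]|]|] [[[v|]|]|] //=; try by split=> // ?; lia.
by split=> [/(dist_eq0 dD)->|[->]]; rewrite ?d0.
Qed.

(** After reversal the returns of lengths 3 and 4 take the place of [d b c] and [d a c], so the
    attachment can be repeated. *)
Lemma ext_end_col : end_col (converse ext_rel) (converse_dist ext_dist)
  None (Some None) (Some (Some None)).
Proof. by split. Qed.

Definition old_part (X : {set ext_vertex}) : {set T} :=
  [set x | old x \in X]%SET.

Lemma card_ext (X : {set ext_vertex}) :
  #|X| = #|old_part X| + (None \in X) + (Some None \in X)
         + (Some (Some None) \in X).
Proof.
have card_option (U : finType) (Y : {set option U}) :
    #|Y| = #|[set x | Some x \in Y]%SET| + (None \in Y).
  rewrite (cardsD1 None) addnC; congr (_ + _).
  have inj : injective (@Some U) by move=> x y [].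
  rewrite -(card_imset _ inj); apply: eq_card => y.
  rewrite !finset.inE; apply/andP/imsetP => [[]|[x + ->]].
    by case: y => // x _ xY; exists x; rewrite ?finset.inE.
  by rewrite finset.inE.
rewrite 3!card_option !finset.inE.
suff -> : #|old_part X| = #|[set x | Some x \in [set x | Some x \in
    [set x | Some x \in X]]]%SET|;
  first by rewrite -!addnA; congr (_ + _);
           rewrite addnC [X in X + _]addnC -addnA.
by apply: eq_card => x; rewrite !finset.inE.
Qed.

Lemma old_part_closed (X : {set ext_vertex}) :
  geo_closed ext_dist X -> geo_closed d (old_part X).
Proof.
move=> cX u v w; rewrite !finset.inE => uX vX duv.
exact: (cX (old u) (old v) (old w)).
Qed.

(** The new column lies on a path of length 4 from [a] to [c], which is a geodesic since
    [d a c = 4]. *)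
Lemma old_part_full (X : {set ext_vertex}) :
  geo_closed ext_dist X -> a \in old_part X -> c \in old_part X ->
  [/\ None \in X, Some None \in X & Some (Some None) \in X].
Proof.
have [ca bc ac ba cb] := end_col_dist.
move=> cX; rewrite !finset.inE => aX cX'.
have H w : ext_dist (old a) w + ext_dist w (old c) = 4 -> w \in X.
  by move=> e; apply: (cX (old a) (old c)); rewrite //= ac.
have ab : d a b <> 0 by move/(dist_eq0 dD) => e; move: ba; rewrite -e d0.
by split; apply: H; rewrite /= !d0; lia.
Qed.

(** Every walk out of the new column passes [c], every walk into it passes [a] or [b], and [b] lies
    on a geodesic from [c] to [a]. Of two new vertices, the later one reaches the earlier one only
    through [c]. *)
Lemma ext_closed_new (X : {set ext_vertex}) z y :
  geo_closed ext_dist X -> z \in X -> (forall x, z <> old x) ->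
  y \in X -> y <> z -> b \in old_part X /\ c \in old_part X.
Proof.
have [ca bc ac ba cb] := end_col_dist; move=> cX.
have ab : d a b <> 0 by move/(dist_eq0 dD) => e; move: ba; rewrite -e d0.
have btw u v w : u \in X -> v \in X ->
  ext_dist u w + ext_dist w v = ext_dist u v -> w \in X by exact: cX.
have ac_b : old a \in X -> old c \in X -> old b \in X.
  by move=> aX cX'; apply: (btw (old c) (old a)); rewrite //=; lia.
have oldA x : None \in X -> old x \in X -> old b \in X /\ old c \in X.
  move=> aX xX.
  have cX' : old c \in X by apply: (btw None (old x)); rewrite //= d0; lia.
  split=> //; apply: ac_b => //.
  by apply: (btw (old x) None); rewrite //= d0; lia.
have oldB x : Some None \in X -> old x \in X -> old b \in X /\ old c \in X.
  move=> bX xX.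
  have cX' : old c \in X.
    by apply: (btw (Some None) (old x)); rewrite //= d0; lia.
  split=> //; have [le|lt] := leqP (d x b) (d x a).+1.
    by apply: (btw (old x) (Some None)); rewrite //= d0; have := tri b x a; lia.
  apply: ac_b => //.
  apply: (btw (old x) (Some None)); rewrite //= d0.
  by have := tri b x a; lia.
have oldC x : Some (Some None) \in X -> old x \in X ->
    old b \in X /\ old c \in X.
  move=> cX' xX; apply: (oldB x) => //.
  by apply: (btw (old x) (Some (Some None))); rewrite //=; lia.
move=> zX nz yX nyz; rewrite !finset.inE.
have main u v : u \in X -> v \in X ->
    ext_dist u (old c) + ext_dist (old c) v = ext_dist u v ->
    (forall x, u <> old x) -> old b \in X /\ old c \in X.
  move=> uX vX /(btw _ _ _ uX vX) cX' nu.
  case: u uX nu {vX} => [[[x|]|]|] uX nu; first by case: (nu x).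
  - exact: (oldC c).
  - exact: (oldB c).
  - exact: (oldA c).
case: z zX nz nyz => [[[z|]|]|] zX nz nyz; first by case: (nz z).
- case: y yX nyz => [[[y|]|]|] // yX _; first exact: (oldC y).
    by apply: (main (Some (Some None)) (Some None)); rewrite //= d0; lia.
  by apply: (main (Some (Some None)) None); rewrite //= d0; lia.
- case: y yX nyz => [[[y|]|]|] // yX _; first exact: (oldB y).
    by apply: (main (Some (Some None)) (Some None)); rewrite //= d0; lia.
  by apply: (main (Some None) None); rewrite //= d0; lia.
- case: y yX nyz => [[[y|]|]|] // yX _; first exact: (oldA y).
    by apply: (main (Some (Some None)) None); rewrite //= d0; lia.
  by apply: (main (Some None) None); rewrite //= d0; lia.
Qed.

Definition ext_set S : {set ext_vertex} :=
  [set u | if u is Some (Some (Some x)) then x \in S else true]%SET.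

(** An old vertex on a geodesic with a new endpoint remains on a geodesic when a new source is
    replaced by [c] and a new target by [a] or [b]. *)
Lemma ext_set_closed S : geo_closed d S -> a \in S -> b \in S -> c \in S ->
  geo_closed ext_dist (ext_set S).
Proof.
have [ca bc ac ba cb] := end_col_dist.
move=> cS aS bS cS' u v [[[w|]|]|]; rewrite !finset.inE //.
case: u => [[[u|]|]|]; case: v => [[[v|]|]|] //= uS vS duv.
{ exact: (cS u v). }
all: try lia.
all: try by [apply: (cS u a) => //; lia | apply: (cS c v) => //; lia
            | apply: (cS c a) => //; lia].
all: have [le|lt] := leqP (d w b) (d w a).+1.
- by apply: (cS u b) => //; have := tri w u b; lia.
- by apply: (cS u a) => //; have := tri w u a; lia.
- by apply: (cS u b) => //; have := tri w u b; lia.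
- by apply: (cS u a) => //; have := tri w u a; lia.
- by apply: (cS c b) => //; have := tri w c b; lia.
- by apply: (cS c a) => //; have := tri w c a; lia.
Qed.

End Extension.

(** * Growing orientations of grids *)

Definition grid_adj (p q : nat * nat) : bool :=
  (p.1 == q.1) && ((p.2.+1 == q.2) || (q.2.+1 == p.2)) ||
  (p.2 == q.2) && ((p.1.+1 == q.1) || (q.1.+1 == p.1)).

Section Layout.
Variable T : finType.
Implicit Types (D : rel T) (d : T -> T -> nat) (f : T -> nat * nat).
Implicit Types (S X : {set T}) (a b c : T).

(** By the cardinality, [f] is a bijection onto the grid. The vertex type stays arbitrary because
    attaching a column changes it. *)
Definition grid_layout n f : Prop :=
  [/\ injective f, forall x, (f x).1 < n /\ (f x).2 < 3 & #|T| = 3 * n].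

Definition oriented_grid n D d f : Prop :=
  [/\ grid_layout n f, is_dist D d &
      orientation (fun x y => grid_adj (f x) (f y)) D].

Definition con_witness n r d S : Prop :=
  [/\ 0 < r < 3 * n, geo_closed d S, #|S| = r &
      forall X, geo_closed d X -> X <> [set: T]%SET -> #|X| <= r].

(** The index [i] is the row of [a], one of the outer rows. The disjunction accounts for the
    reversal of arcs at each attachment. *)
Definition grid_end D d f k a b c : Prop :=
  (end_col D d a b c \/ end_col (converse D) (converse_dist d) a b c) /\
  exists2 i, i = 0 \/ i = 2 &
    [/\ f a = (k, i), f b = (k, 1) & f c = (k, 2 - i)].

Definition absorbing d b c : Prop :=
  forall X, geo_closed d X -> b \in X -> c \in X -> X = [set: T]%SET.

Lemma grid_end_converse D d f k a b c :
  grid_end D d f k a b c ->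
  grid_end (converse D) (converse_dist d) f k a b c.
Proof. by case=> e ?; split=> //; case: e; [right|left]. Qed.

Lemma absorbing_converse d b c :
  absorbing d b c -> absorbing (converse_dist d) b c.
Proof. by move=> abs X /closed_converse; apply: abs. Qed.

Lemma oriented_grid_converse n D d f :
  oriented_grid n D d f -> oriented_grid n (converse D) (converse_dist d) f.
Proof.
case=> gf dD oD; split=> //; first exact: is_dist_converse.
by move=> u v; rewrite /converse orbC andbC; apply: oD.
Qed.

Lemma con_witness_converse n r d S :
  con_witness n r d S -> con_witness n r (converse_dist d) S.
Proof.
case=> r0 cS cardS max; split=> //; first exact/closed_converse.
by move=> X /closed_converse; apply: max.
Qed.

End Layout.

(* [l] asks that the convex set of cardinality [r] contain the first column, so
   that it can grow along a new column on the left; [h] asks that no proper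
   convex set reach the last column. *)
Definition realizable (l h : bool) n r : Prop :=
  exists (T : finType) (D : rel T) d f (S : {set T}),
  [/\ oriented_grid n D d f, con_witness n r d S,
      l -> exists a b c,
        grid_end D d f 0 a b c /\ [/\ a \in S, b \in S & c \in S] &
      h -> exists a b c, grid_end D d f n.-1 a b c /\ absorbing d b c].

Section Extend.
Variables (T : finType) (D : rel T) (d : T -> T -> nat) (f : T -> nat * nat).
Variables (n r : nat) (S : {set T}) (a b c : T) (k i : nat).
Hypotheses (gD : oriented_grid n D d f) (wS : con_witness n r d S).
Hypotheses (eabc : end_col D d a b c) (hi : i = 0 \/ i = 2).
Hypotheses (fa : f a = (k, i)) (fb : f b = (k, 1)) (fc : f c = (k, 2 - i)).

Local Notation E := (ext_vertex T).
Local Notation D' := (ext_rel D a b c).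
Local Notation d' := (ext_dist d a b c).

(** Old columns are shifted by [s] and the new one gets index [k']: [s = 1], [k' = 0] on the left
    and [s = 0], [k' = n] on the right. *)
Definition ext_layout (s k' : nat) (u : E) : nat * nat :=
  match u with
  | Some (Some (Some x)) => (s + (f x).1, (f x).2)
  | Some (Some None) => (k', 2 - i)
  | Some None => (k', 1)
  | None => (k', i)
  end.

Lemma ext_oriented_grid s k' :
  k = 0 /\ s = 1 /\ k' = 0 \/ k = n.-1 /\ s = 0 /\ k' = n ->
  oriented_grid n.+1 D' d' (ext_layout s k').
Proof.
move=> hk; have [[injf bnd cardT] dD oD] := gD.
have eqf x y : (f x).1 = (f y).1 -> (f x).2 = (f y).2 -> x = y.
  move=> e1 e2; apply: injf.
  by rewrite [LHS]surjective_pairing e1 e2 -surjective_pairing.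
(* Each new position is adjacent to exactly one old vertex, the one in the same row of column
   [k]. *)
have adj_new x y j : f y = (k, j) ->
    grid_adj (s + (f x).1, (f x).2) (k', j) = (x == y).
  move=> fy; have := bnd x; have := bnd y; rewrite fy /grid_adj /=.
  move=> [ly _] [lx _].
  have [->|/eqP nxy] := eqVneq x y; first by rewrite fy /=; lia.
  have : (f x).1 <> k \/ (f x).2 <> j; last lia.
  have [e1|/eqP] := eqVneq (f x).1 k; last by left.
  have [e2|/eqP] := eqVneq (f x).2 j; last by right.
  by case: nxy; apply: eqf; rewrite fy.
have adj_sym p q : grid_adj p q = grid_adj q p by rewrite /grid_adj; lia.
have fne x j : (s + (f x).1, (f x).2) <> (k', j).
  by case=> e _; have := (bnd x).1; lia.
split; last 1 first.
- move=> [[[u|]|]|] [[[v|]|]|] /=;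
    rewrite ?[grid_adj (k', _) (s + _, _)]adj_sym ?(adj_new _ _ _ fa)
      ?(adj_new _ _ _ fb) ?(adj_new _ _ _ fc) ?orbF ?andbF ?orbb //;
  try by rewrite /grid_adj /=; case: hi => hi'; rewrite ?hi'; lia.
  have -> : grid_adj (s + (f u).1, (f u).2) (s + (f v).1, (f v).2) =
            grid_adj (f u) (f v) by rewrite /grid_adj /=; lia.
  exact: oD.
- split.
  + move=> [[[u|]|]|] [[[v|]|]|] //= e;
      try (by case: (fne _ _ e)); try (by case: (fne _ _ (esym e)));
      try (by case: e; lia).
    by case: e => e1 e2; congr (Some (Some (Some _))); apply: eqf; lia.
  + move=> [[[u|]|]|] /=; try lia.
    by have := bnd u; lia.
  + by rewrite !card_option cardT; lia.
- exact: ext_is_dist.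
Qed.

Lemma ext_grid_end s k' :
  grid_end D' d' (ext_layout s k') k' None (Some None) (Some (Some None)).
Proof. by split; [right; apply: ext_end_col | exists i]. Qed.

Lemma ext_grid_end_old s k' l x y z : grid_end D d f l x y z ->
  grid_end D' d' (ext_layout s k') (s + l) (old x) (old y) (old z).
Proof.
case=> e [j hj [fx fy fz]]; split; first exact: e.
by exists j => //=; rewrite fx fy fz.
Qed.

Lemma old_part_setT (X : {set E}) :
  geo_closed d' X -> old_part X = [set: T]%SET -> X = [set: E]%SET.
Proof.
have [_ dD _] := gD; move=> cX oX.
have inT x : x \in old_part X by rewrite oX finset.in_setT.
have inX x : old x \in X.
  by have := inT x; rewrite finset.inE.
have [? ? ?] := old_part_full dD eabc cX (inT a) (inT c).
by apply/setP => -[[[x|]|]|]; rewrite finset.in_setT //; exact: inX.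
Qed.

Lemma absorbing_old y z : absorbing d y z -> absorbing d' (old y) (old z).
Proof.
move=> abs X cX yX zX; apply: old_part_setT => //.
by apply: abs; rewrite ?finset.inE //; apply: old_part_closed cX.
Qed.

Lemma absorbing_ext : absorbing d b c ->
  absorbing d' (Some None) (Some (Some None)).
Proof.
have [_ dD _] := gD; move=> abs X cX bX cX'; apply: old_part_setT => //.
have nb (x : T) : Some None <> old x by [].
have [? ?] := ext_closed_new dD eabc cX bX nb cX' ltac:(by []).
by apply: abs => //; apply: old_part_closed cX.
Qed.

(** A proper closed set has a proper old part, since a full old part forces the new column; hence it
    has at most [r + 3] elements. *)
Lemma con_witness_left : a \in S -> b \in S -> c \in S ->
  con_witness n.+1 (r + 3) d' (ext_set S).
Proof.
clear hi; have [_ dD _] := gD; case: wS => r0 cS cardS max aS bS cS'; split.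
- by lia.
- exact: (ext_set_closed dD eabc).
- rewrite card_ext !finset.inE; have -> : old_part (ext_set S) = S.
    by apply/setP => x; rewrite !finset.inE.
  by rewrite cardS -!addnA.
- move=> X cX nX; rewrite card_ext.
  suff : #|old_part X| <= r by lia.
  apply: max; first exact: old_part_closed cX.
  by move=> /(old_part_setT cX).
Qed.

(** A geodesic between vertices of [S] through the new column would put [b] and [c] into [S], which
    is proper. A closed set with a new vertex and any other vertex contains [b] and [c], hence
    everything. *)
Lemma con_witness_right : absorbing d b c ->
  con_witness n.+1 r d' (@old T @: S).
Proof.
clear hi; have [[_ _ cardT] dD _] := gD; case: wS => r0 cS cardS max abs.
have old_inj : injective (@old T) by move=> x y [].
have nbc : b \in S -> c \in S -> False.
  move=> bS cS'; have := abs S cS bS cS' => e.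
  by move: cardS; rewrite e cardsT cardT; lia.
have inS x : (old x \in @old T @: S) = (x \in S) by rewrite mem_imset.
split.
- by lia.
- move=> _ _ w /imsetP[u uS ->] /imsetP[v vS ->].
  have [ca bc ac ba cb] := end_col_dist dD eabc.
  have tri := dist_triangle dD.
  have btw x : d u x + d x v = d u v -> x \in S by apply: cS.
  have nac : d u a + d a v = d u v -> d u c + d c v = d u v -> False.
    move=> /btw aS /btw cS'; apply: nbc => //; apply: (cS c a) => //; lia.
  have [t1 t2 t3 t4] := And4 (tri a u v) (tri b u v) (tri c u v) (tri c a v).
  have [t5 t6 t7] := And3 (tri c b v) (tri a u c) (tri b u c).
  case: w => [[[w|]|]|] /=; first by rewrite inS; apply: cS.
  + have [le|lt] := leqP (d u b) (d u a).+1 => e; exfalso.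
      by apply: nbc; apply: btw; lia.
    by apply: nac; lia.
  + have [le|lt] := leqP (d u b) (d u a).+1 => e; exfalso.
      by apply: nbc; apply: btw; lia.
    by apply: nac; lia.
  + by move=> e; exfalso; apply: nac; lia.
- by rewrite card_imset.
- move=> X cX nX.
  have [[z [zX zn]]|none] :=
      pselect (exists z, z \in X /\ forall x, z <> old x).
    suff : #|X| <= 1 by lia.
    rewrite leqNgt; apply/negP => /card_gt1P[x [y [xX yX nxy]]].
    have [y' y'X ny'] : exists2 y, y \in X & y <> z.
      have [xz|/eqP] := eqVneq x z; last by exists x.
      by exists y => //; apply/eqP; rewrite -xz eq_sym.
    have [bX cX'] := ext_closed_new dD eabc cX zX zn y'X ny'.
    case: nX; apply: old_part_setT => //.
    by apply: abs => //; apply: old_part_closed cX.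
  rewrite card_ext; suff : #|old_part X| <= r.
    have nz z : (forall x, z <> old x) -> (z \in X) = false.
      by move=> zn; apply/negP => zX; apply: none; exists z.
    by rewrite !nz //; lia.
  apply: max; first exact: old_part_closed cX.
  by move=> /(old_part_setT cX).
Qed.

End Extend.

Lemma realizable_left h n r :
  realizable true h n r -> realizable true h n.+1 (r + 3).
Proof.
case=> T [D [d [f [S [gD wS]]]]] /(_ isT)[a [b [c [end0 [aS bS cS]]]]] hR.
(* Reversing all arcs preserves closed sets, so the end column may be taken in the direction of
   [end_col]. *)
wlog e : D d gD wS end0 hR / end_col D d a b c.
  move=> main; case: (end0) => -[e|e] _; first exact: (main D d).
  apply: (main (converse D) (converse_dist d)) => //.
  - exact: oriented_grid_converse.
  - exact: con_witness_converse.
  - exact: grid_end_converse.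
  - move=> /hR[x [y [z [/grid_end_converse ? /absorbing_converse ?]]]].
    by exists x, y, z.
case: end0 => _ [i hi [fa fb fc]].
have n0 : 0 < n by case: gD => -[_ /(_ a) + _] _ _; lia.
exists (ext_vertex T), (ext_rel D a b c), (ext_dist d a b c).
exists (ext_layout f i 1 0), (ext_set S); split.
- by apply: (ext_oriented_grid gD e hi fa fb fc); left.
- by apply: (con_witness_left gD wS e).
- move=> _; exists None, (Some None), (Some (Some None)).
  by split; [exact: ext_grid_end | rewrite !finset.inE].
- move=> /hR[x [y [z [exyz abs]]]]; exists (old x), (old y), (old z); split.
    have -> : n.+1.-1 = 1 + n.-1 by lia.
    exact: ext_grid_end_old.
  exact: (absorbing_old gD e abs).
Qed.

Lemma realizable_right l n r :
  realizable l true n r -> realizable false true n.+1 r.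
Proof.
case=> T [D [d [f [S [gD wS _]]]]] /(_ isT)[a [b [c [end_n abs]]]].
wlog e : D d gD wS end_n abs / end_col D d a b c.
  move=> main; case: (end_n) => -[e|e] _; first exact: (main D d).
  apply: (main (converse D) (converse_dist d)) => //.
  - exact: oriented_grid_converse.
  - exact: con_witness_converse.
  - exact: grid_end_converse.
  - exact: absorbing_converse.
case: end_n => _ [i hi [fa fb fc]].
exists (ext_vertex T), (ext_rel D a b c), (ext_dist d a b c).
exists (ext_layout f i 0 n), (@old T @: S); split=> //.
- by apply: (ext_oriented_grid gD e hi fa fb fc); right.
- exact: (con_witness_right gD wS e).
- move=> _; exists None, (Some None), (Some (Some None)).
  by split; [exact: ext_grid_end | apply: (absorbing_ext gD)].
Qed.

(** * Transport to the product of paths *)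

Lemma grid_adjE n (p q : 'I_n * 'I_3) :
  cart_prod (path_graph n) (path_graph 3) p q =
  grid_adj (val p.1, val p.2) (val q.1, val q.2).
Proof. by []. Qed.

Lemma con_eq (T : finType) (D : rel T) d (S : {set T}) r :
  is_dist D d -> geo_closed d S -> #|S| = r -> 0 < r < #|T| ->
  (forall X : {set T}, geo_closed d X -> X <> [set: T]%SET -> #|X| <= r) ->
  con D = r.
Proof.
move=> dD cS cardS r0 max; apply/eqP; rewrite eqn_leq; apply/andP; split.
  apply/bigmax_leqP => X /andP[/asboolP/(convexP dD)[_ cX] /eqP nX].
  exact: max.
rewrite -cardS; apply: (@leq_bigmax_cond _ _ (fun X : {set T} => #|X|) S).
apply/andP; split.
  apply/asboolP/(convexP dD); split=> //.
  by apply/eqP => S0; rewrite S0 cards0 in cardS; lia.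
by apply/eqP => ST; rewrite ST cardsT in cardS; lia.
Qed.

(** The layout is injective between sets of equal size, hence a bijection, along which arcs,
    distances and closed sets are carried over. *)
Lemma realizable_spectrum l h n r : realizable l h n r ->
  strong_convexity_spectrum (cart_prod (path_graph n) (path_graph 3)) r.
Proof.
case=> T [D [d [f [S [[[injf bnd cardT] dD oD] [r0 cS cardS max] _ _]]]]].
pose g x : 'I_n * 'I_3 := (Ordinal (bnd x).1, Ordinal (bnd x).2).
have injg : injective g.
  move=> x y [e1 e2]; apply: injf.
  by rewrite [LHS]surjective_pairing e1 e2 -surjective_pairing.
have [|k gK kK] := inj_card_bij injg.
  by rewrite card_prod !card_ord cardT mulnC.
have injk := can_inj kK.
have fk p : f (k p) = (val p.1, val p.2).
  by rewrite -[in RHS](kK p) -surjective_pairing.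
pose D' : rel ('I_n * 'I_3) := fun p q => D (k p) (k q).
pose d' (p q : 'I_n * 'I_3) := d (k p) (k q).
have dD' : is_dist D' d'.
  split=> [p q|p q s|p q npq]; rewrite /d'.
  - by split=> [/(dist_eq0 dD)/injk|->]; last exact: dist0 dD _.
  - by move=> ?; apply: (dist_step dD).
  - have [|y xy dy] := dist_first dD (u := k p) (v := k q) _.
      by move/injk.
    by exists (g y); rewrite /D' gK.
exists D'; first split.
- by move=> p q; rewrite grid_adjE -!fk; apply: oD.
- exact: dist_strong dD'.
- have closed_im X : geo_closed d' X -> geo_closed d (k @: X).
    move=> cX _ _ w /imsetP[u uX ->] /imsetP[v vX ->] duv.
    rewrite -(gK w) imset_f //; apply: (cX u v) => //.
    by rewrite /d' gK.
  apply: (@con_eq _ _ d' (k @^-1: S)) => //.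
  + by move=> u v w; rewrite !finset.inE; apply: cS.
  + by rewrite on_card_preimset //; exists g => x _.
  + by rewrite card_prod !card_ord mulnC.
  + move=> X cX nX; rewrite -(card_imset _ injk).
    apply: max; first exact: closed_im.
    move=> e; apply: nX; apply/setP => p.
    by rewrite finset.in_setT -(mem_imset _ _ injk) e finset.in_setT.
Qed.

(** * Small orientations checked by computation *)

Section Check.
Variables (n r : nat).
Let N := 3 * n.

(* Vertex [3 * i + j] stands for row [j] of column [i]. Entry [i] of [o] lists
   five bits: whether (i,0)->(i,1), (i,1)->(i,2), and (i,j)->(i+1,j) for
   j = 0, 1, 2; a zero means the opposite arc. *)
Definition arc_of (o : seq (seq nat)) (u v : nat) : bool :=
  let: (i, j) := (u %/ 3, u %% 3) in
  let: (i', j') := (v %/ 3, v %% 3) in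
  let bit i j := nth 0 (nth [::] o i) j == 1 in
  (i == i') && ((j.+1 == j') && bit i j || (j'.+1 == j) && ~~ bit i j') ||
  (j == j') && ((i.+1 == i') && bit i j.+2 || (i'.+1 == i) && ~~ bit i' j.+2).

(** Bellman-Ford iteration with [N] standing for infinity. The resulting table is certified
    afterwards by [dist_check]. *)
Definition dist_table (o : seq (seq nat)) : seq (seq nat) :=
  let relax m :=
    [seq (let rows := [seq nth [::] m w | w <- iota 0 N & arc_of o u w] in
          [seq (if u == v then 0 else
                foldr minn N [seq (nth 0 row v).+1 | row <- rows])
          | v <- iota 0 N])
    | u <- iota 0 N] in
  iter N relax (nseq N (nseq N N)).

Variables (D : nat -> nat -> bool) (m : seq (seq nat)).
Let d u v := nth 0 (nth [::] m u) v.

Definition all_vertices (P : nat -> bool) := all P (iota 0 N).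

Lemma all_verticesP (P : nat -> bool) (u : 'I_N) : all_vertices P -> P u.
Proof. by move/allP; apply; rewrite mem_iota ltn_ord. Qed.

Definition dist_check : bool :=
  all_vertices (fun u => all_vertices (fun v =>
    [&& (d u v == 0) == (u == v),
        (u == v) || has (fun w => D u w && (d u v == (d w v).+1)) (iota 0 N) &
        all_vertices (fun w => D u w ==> (d u v <= (d w v).+1))])).

Definition orientation_check : bool :=
  all_vertices (fun u => all_vertices (fun v =>
    (D u v || D v u == grid_adj (u %/ 3, u %% 3) (v %/ 3, v %% 3)) &&
    ~~ (D u v && D v u))).

Definition hull_step (L : seq nat) : seq nat :=
  [seq w <- iota 0 N | if w \in L then true else
     has (fun u => has (fun v => d u w + d w v == d u v) L) L].

Fixpoint hull (k : nat) (L : seq nat) : seq nat :=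
  if k is k'.+1 then
    let L' := hull_step L in if size L' == size L then L else hull k' L'
  else L.

(* Explores all chains of hulls; [k] bounds the length of a chain. Conditionals
   are used because [||] and [&&] evaluate both arguments under [vm_compute]. *)
Fixpoint con_check (k : nat) (L : seq nat) : bool :=
  let H := hull N L in
  if all_vertices (mem H) then true else
  if r < size H then false else
  if k is k'.+1 then
    all_vertices (fun y => if y \in H then true else
        if has (D^~ y) H then con_check k' (y :: H) else true)
  else false.

Definition end_col_check (E : nat -> nat -> bool) (e : nat -> nat -> nat)
    a b c :=
  [&& E c b, E b a, e c a == 2, e b c == 3 & e a c == 4].

Definition grid_end_check (k : nat) (Q : nat -> nat -> nat -> bool) : bool :=
  has (fun i => let: (a, b, c) := (3 * k + i, 3 * k + 1, 3 * k + (2 - i)) in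
    (end_col_check D d a b c ||
     end_col_check (fun u v => D v u) (fun u v => d v u) a b c) && Q a b c)
    [:: 0; 2].

Definition contained (L : seq nat) (X : {set 'I_N}) : Prop :=
  forall x, x \in L -> exists2 y : 'I_N, y \in X & y = x :> nat.

Let D' : rel 'I_N := fun u v => D u v.
Let d' (u v : 'I_N) := d u v.

Lemma dist_checkP : dist_check -> is_dist D' d'.
Proof.
move=> chk; have {}chk (u v : 'I_N) := all_verticesP v (all_verticesP u chk).
split=> [u v|u v w|u v nuv]; have /and3P[/eqP d0 first step] := chk u v.
- split=> [/eqP|uv]; first by rewrite /d' d0 => /eqP/val_inj.
  by apply/eqP; rewrite /d' d0 uv.
- by move=> uw; have /implyP := all_verticesP w step; apply.
- case/orP: first => [/eqP/val_inj//|/hasP[w]].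
  rewrite mem_iota => wN /andP[uw /eqP duv].
  by exists (Ordinal wN).
Qed.

Lemma hull_step_contained L (X : {set 'I_N}) :
  geo_closed d' X -> contained L X -> contained (hull_step L) X.
Proof.
move=> cX LX w; rewrite mem_filter => /andP[+]; rewrite mem_iota => + wN.
case: ifP => [/LX //|_ /hasP[u /LX[u' u'X <-]] /hasP[v /LX[v' v'X <-]] /eqP e].
by exists (Ordinal wN) => //; apply: (cX u' v').
Qed.

Lemma hull_contained k L (X : {set 'I_N}) :
  geo_closed d' X -> contained L X -> contained (hull k L) X.
Proof.
move=> cX; elim: k L => //= k IH L LX; case: ifP => // _; apply: IH.
exact: hull_step_contained.
Qed.

Lemma sub_hull k L (X : {set 'I_N}) :
  geo_closed d' X -> contained L X -> {subset L <= hull k L}.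
Proof.
move=> cX; elim: k L => [|k IH] L LX x xL //=; case: ifP => // _; apply: IH.
  exact: hull_step_contained.
by have [y _ yx] := LX x xL; rewrite mem_filter mem_iota xL -yx ltn_ord.
Qed.

Lemma contained_setT L (X : {set 'I_N}) :
  contained L X -> all_vertices (mem L) -> X = [set: 'I_N]%SET.
Proof.
move=> LX full; apply/setP => x; rewrite finset.in_setT.
by have [y yX /val_inj <-] := LX _ (all_verticesP x full).
Qed.

(** Either [X] lies in the hull [H] found so far, and [size H] bounds its cardinality, or by
    [closed_exit] some arc inside [X] leaves [H]; this is why the search adds only out-neighbours of
    [H]. *)
Lemma con_checkP k L (X : {set 'I_N}) : is_dist D' d' -> con_check k L ->
  geo_closed d' X -> X <> [set: 'I_N]%SET -> contained L X -> 0 < size L ->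
  #|X| <= r.
Proof.
move=> dD + cX nX.
have not_full L' : contained L' X -> all_vertices (mem (hull N L')) = false.
  move=> LX; apply/negP => full; case: nX.
  by apply: contained_setT full; apply: hull_contained.
elim: k L => [|k IH] L + LX L0; rewrite /= not_full //; first by case: ifP.
case: ltnP => // szH chk; set H := hull N L in szH chk.
have HX : contained H X by exact: hull_contained.
have [sub|] := boolP [forall x in X, val x \in H].
  apply: leq_trans szH; rewrite cardE -(size_map val).
  apply: uniq_leq_size; first by rewrite (map_inj_uniq val_inj) enum_uniq.
  move=> _ /mapP[x + ->]; rewrite mem_enum => xX.
  by have /forall_inP := sub; apply.
rewrite negb_forall => /existsP[z]; rewrite negb_imply => /andP[zX zH].
have [x0 x0L] : exists x, x \in L.
  by exists (head 0 L); case: (L) L0 => // x s _; apply: mem_head.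
have [x1 x1X x1E] := LX _ x0L.
have x1H : (x1 : nat) \in H by rewrite x1E; apply: (sub_hull N cX LX).
have [x [y [xX yX xy xH yH]]] :=
  closed_exit (A := fun x : 'I_N => (x : nat) \in H) dD cX x1X zX x1H zH.
have := all_verticesP y chk; rewrite (negPf yH).
have -> : has (D^~ y) H by apply/hasP; exists (x : nat).
move=> chk'; apply: (IH _ chk') => // w; rewrite inE => /orP[/eqP->|/HX //].
by exists y.
Qed.

Lemma orientation_checkP : orientation_check ->
  orientation (fun u v : 'I_N => grid_adj (u %/ 3, u %% 3) (v %/ 3, v %% 3)) D'.
Proof.
move=> chk u v.
by have /andP[/eqP e ne] := all_verticesP v (all_verticesP u chk); split.
Qed.

Lemma grid_end_checkP k (Q : nat -> nat -> nat -> bool) : k < n ->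
  grid_end_check k Q -> exists a b c : 'I_N,
    grid_end D' d' (fun u : 'I_N => (u %/ 3, u %% 3)) k a b c /\ Q a b c.
Proof.
move=> kn chk.
have [i hi /andP[ends Qabc]] : exists2 i, i = 0 \/ i = 2 &
    (end_col_check D d (3 * k + i) (3 * k + 1) (3 * k + (2 - i)) ||
     end_col_check (fun u v => D v u) (fun u v => d v u)
       (3 * k + i) (3 * k + 1) (3 * k + (2 - i))) &&
    Q (3 * k + i) (3 * k + 1) (3 * k + (2 - i)).
  by case/or3P: chk => // chk; [exists 0 | exists 2] => //; [left | right].
have iN : 3 * k + i < N by rewrite /N; lia.
have bN : 3 * k + 1 < N by rewrite /N; lia.
have cN : 3 * k + (2 - i) < N by rewrite /N; lia.
exists (Ordinal iN), (Ordinal bN), (Ordinal cN); split=> //; split.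
  by case/orP: ends => /and5P[? ? /eqP ? /eqP ? /eqP ?]; [left | right].
by exists i => //=; split; congr (_, _); lia.
Qed.

End Check.

(* [L] lists the vertices of a convex set of cardinality [r]. *)
Definition base_check (l h : bool) n r (o : seq (seq nat)) (L : seq nat) :
    bool :=
  let D := arc_of o in
  let m := dist_table n o in
  [&& 0 < r < 3 * n, dist_check n D m, orientation_check n D,
      all (mem L) (hull_step n m L), count (mem L) (iota 0 (3 * n)) == r,
      all_vertices n (fun x => con_check n r D m (3 * n) [:: x]),
      l ==> grid_end_check D m 0 (fun a b c => all (mem L) [:: a; b; c]) &
      h ==> grid_end_check D m n.-1 (fun _ b c =>
        all_vertices n (mem (hull n m (3 * n) [:: b; c])))].

Lemma base_checkP l h n r o L : base_check l h n r o L -> realizable l h n r.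
Proof.
case/and5P=> r0 /dist_checkP dD /orientation_checkP oD /allP cS.
case/and4P=> /eqP cardS max /implyP hl /implyP hh.
pose f (u : 'I_(3 * n)) := (u %/ 3, u %% 3).
pose S := [set x : 'I_(3 * n) | (x : nat) \in L]%SET.
exists 'I_(3 * n), (fun u v : 'I_(3 * n) => arc_of o u v).
exists (fun u v : 'I_(3 * n) => nth 0 (nth [::] (dist_table n o) u) v), f, S.
split.
- split; [split|exact: dD|exact: oD].
  + move=> u v [e1 e2]; apply: val_inj.
    by rewrite /= (divn_eq u 3) e1 e2 -divn_eq.
  + move=> u; split; last exact: ltn_pmod.
    by rewrite /= ltn_divLR // [n * 3]mulnC.
  + exact: card_ord.
- split=> //.
  + move=> u v w; rewrite !finset.inE => uL vL duv.
    apply: cS; rewrite mem_filter mem_iota leq0n ltn_ord !andbT.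
    case: ifP => // _; apply/hasP; exists (u : nat) => //.
    by apply/hasP; exists (v : nat) => //; apply/eqP.
  + rewrite cardsE cardE size_filter -cardS -val_enum_ord count_map.
    by rewrite enumT; apply: eq_count.
  + move=> X cX nX.
    have [->|[x xX]] := set_0Vmem X; first by rewrite cards0.
    apply: (con_checkP dD (all_verticesP x max)) => // y.
    by rewrite inE => /eqP->; exists x.
- have n0 : 0 < n by lia.
  move=> /hl/(grid_end_checkP n0)[a [b [c [abc /and4P[? ? ? _]]]]].
  by exists a, b, c; rewrite !finset.inE.
- have n0 : n.-1 < n by lia.
  move=> /hh/(grid_end_checkP n0)[a [b [c [abc full]]]].
  exists a, b, c; split=> // X cX bX cX'.
  apply: contained_setT full; apply: hull_contained => // x.
  by rewrite !inE => /orP[]/eqP->; [exists b | exists c].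
Qed.

(** * The eleven small orientations *)

Lemma realizable_3_1 : realizable false true 3 1.
Proof.
apply: (@base_checkP _ _ _ _
  [:: [:: 0; 1; 1; 0; 1]; [:: 1; 1; 0; 1; 1]; [:: 0; 0; 0; 0; 0]]
  [:: 0]).
by vm_compute.
Qed.

Lemma realizable_3_4 : realizable false false 3 4.
Proof.
apply: (@base_checkP _ _ _ _
  [:: [:: 0; 0; 1; 1; 0]; [:: 1; 1; 0; 1; 1]; [:: 0; 0; 0; 0; 0]]
  [:: 3; 4; 6; 7]).
by vm_compute.
Qed.

Lemma realizable_4_4 : realizable false true 4 4.
Proof.
apply: (@base_checkP _ _ _ _
  [:: [:: 0; 0; 1; 1; 0]; [:: 0; 1; 1; 0; 1]; [:: 1; 1; 0; 1; 1];
      [:: 0; 0; 0; 0; 0]]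
  [:: 1; 2; 4; 5]).
by vm_compute.
Qed.

Lemma realizable_3_6 : realizable true false 3 6.
Proof.
apply: (@base_checkP _ _ _ _
  [:: [:: 0; 0; 1; 0; 0]; [:: 1; 1; 1; 1; 0]; [:: 1; 1; 0; 0; 0]]
  (iota 0 6)).
by vm_compute.
Qed.

Lemma realizable_4_6 : realizable true false 4 6.
Proof.
apply: (@base_checkP _ _ _ _
  [:: [:: 0; 0; 1; 1; 0]; [:: 1; 1; 1; 1; 0]; [:: 1; 1; 0; 1; 1];
      [:: 0; 0; 0; 0; 0]]
  (iota 0 6)).
by vm_compute.
Qed.

Lemma realizable_5_6 : realizable true true 5 6.
Proof.
apply: (@base_checkP _ _ _ _
  [:: [:: 0; 0; 1; 1; 0]; [:: 1; 1; 0; 0; 1]; [:: 0; 1; 1; 0; 1];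
      [:: 1; 1; 0; 1; 1]; [:: 0; 0; 0; 0; 0]]
  (iota 0 6)).
by vm_compute.
Qed.

Lemma realizable_4_8 : realizable true false 4 8.
Proof.
apply: (@base_checkP _ _ _ _
  [:: [:: 0; 0; 1; 0; 0]; [:: 1; 1; 1; 1; 0]; [:: 0; 1; 1; 1; 0];
      [:: 1; 1; 0; 0; 0]]
  (iota 0 6 ++ [:: 7; 8])).
by vm_compute.
Qed.

Lemma realizable_5_8 : realizable true true 5 8.
Proof.
apply: (@base_checkP _ _ _ _
  [:: [:: 0; 0; 1; 1; 0]; [:: 1; 1; 1; 1; 0]; [:: 0; 1; 1; 0; 1];
      [:: 1; 1; 0; 1; 1]; [:: 0; 0; 0; 0; 0]]
  (iota 0 6 ++ [:: 7; 8])).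
by vm_compute.
Qed.

Lemma realizable_5_10 : realizable true false 5 10.
Proof.
apply: (@base_checkP _ _ _ _
  [:: [:: 0; 0; 1; 1; 0]; [:: 1; 1; 1; 0; 0]; [:: 1; 0; 1; 0; 0];
      [:: 1; 0; 1; 0; 0]; [:: 1; 1; 0; 0; 0]]
  (iota 0 8 ++ [:: 9; 10])).
by vm_compute.
Qed.

Lemma realizable_6_10 : realizable true false 6 10.
Proof.
apply: (@base_checkP _ _ _ _
  [:: [:: 0; 0; 1; 1; 0]; [:: 1; 1; 1; 0; 0]; [:: 1; 0; 1; 0; 0];
      [:: 1; 0; 1; 1; 0]; [:: 1; 0; 1; 1; 0]; [:: 1; 1; 0; 0; 0]]
  (iota 0 8 ++ [:: 9; 10])).
by vm_compute.
Qed.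

Lemma realizable_7_10 : realizable true true 7 10.
Proof.
apply: (@base_checkP _ _ _ _
  [:: [:: 0; 0; 1; 0; 0]; [:: 1; 1; 0; 1; 1]; [:: 0; 1; 1; 0; 1];
      [:: 1; 1; 0; 0; 1]; [:: 0; 1; 1; 0; 1]; [:: 1; 1; 0; 1; 1];
      [:: 0; 0; 0; 0; 0]]
  (iota 0 8 ++ [:: 9; 10])).
by vm_compute.
Qed.

(** * All admissible pairs from the small ones *)

Lemma realizable_iter h k n r :
  realizable true h n r -> realizable true h (n + k) (r + 3 * k).
Proof.
move=> base; elim: k => [|k IH]; first by rewrite muln0 !addn0.
have -> : n + k.+1 = (n + k).+1 by lia.
have -> : r + 3 * k.+1 = r + 3 * k + 3 by lia.
exact: realizable_left.
Qed.

Lemma realizable_widen l m n r :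
  realizable l true m r -> m <= n -> exists l', realizable l' true n r.
Proof.
move=> base /subnK<-; elim: (n - m) => [|k [l' IH]]; first by exists l.
by exists false; rewrite addSn; apply: realizable_right IH.
Qed.

(** For [r] equal to [6 + 3 * k], [8 + 3 * k] or [10 + 3 * k], the bound on [r] gives [n] at least
    [3 + k], [4 + k] or [5 + k]. The first one or two widths come from left growth alone; all larger
    ones by growing [k] times and then widening on the right. *)
Lemma realizable_all n r : 3 <= n -> 1 <= r <= 3 * n - 3 ->
  r <> 2 -> r <> 3 -> r <> 5 -> r <> 7 ->
  exists l h, realizable l h n r.
Proof.
move=> n3 hr r2 r3 r5 r7.
have widen l m r' : realizable l true m r' -> m <= n ->
    exists l' h, realizable l' h n r'.
  by move=> base /(realizable_widen base)[l' ?]; exists l', true.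
have grow h m k r' : realizable true h m r' -> n = m + k ->
    exists l' h, realizable l' h n (r' + 3 * k).
  by move=> base ->; exists true, h; apply: realizable_iter.
have [r1|r1] := eqVneq r 1.
  by rewrite r1; apply: widen realizable_3_1 n3.
have [r4|r4] := eqVneq r 4.
  have [->|n3'] := eqVneq n 3.
    by rewrite r4; exists false, false; apply: realizable_3_4.
  by rewrite r4; apply: widen realizable_4_4 _; lia.
(* The least values left in the residue classes 0, 2 and 1 modulo 3, once 1 to 5 and 7 are removed,
   are 6, 8 and 10. *)
have [[k rk]|[[k rk]|[k rk]]] : (exists k, r = 6 + 3 * k) \/
    (exists k, r = 8 + 3 * k) \/ (exists k, r = 10 + 3 * k).
  have := divn_eq r 3; have := ltn_mod r 3.
  case: (r %% 3) => [|[|[|//]]] _ e.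
  - by left; exists (r %/ 3 - 2); lia.
  - by right; right; exists (r %/ 3 - 3); lia.
  - by right; left; exists (r %/ 3 - 2); lia.
- have [e|n3'] := eqVneq n (3 + k).
    by rewrite rk; apply: grow realizable_3_6 e.
  have [e|n4] := eqVneq n (4 + k).
    by rewrite rk; apply: grow realizable_4_6 e.
  by rewrite rk; apply: widen (realizable_iter k realizable_5_6) _; lia.
- have [e|n4] := eqVneq n (4 + k).
    by rewrite rk; apply: grow realizable_4_8 e.
  by rewrite rk; apply: widen (realizable_iter k realizable_5_8) _; lia.
- have [e|n5] := eqVneq n (5 + k).
    by rewrite rk; apply: grow realizable_5_10 e.
  have [e|n6] := eqVneq n (6 + k).
    by rewrite rk; apply: grow realizable_6_10 e.
  by rewrite rk; apply: widen (realizable_iter k realizable_7_10) _; lia.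
Qed.

(** * Excluded convexity numbers *)

Lemma grid_adj_sym p q : grid_adj p q = grid_adj q p.
Proof. by rewrite /grid_adj; lia. Qed.

Lemma grid_adj_odd p q :
  grid_adj p q -> odd (q.1 + q.2) = ~~ odd (p.1 + p.2).
Proof. by rewrite /grid_adj; lia. Qed.

(* [z] is the reflection of one endpoint in the other. *)
Lemma grid_extend n (p q : nat * nat) : 3 <= n ->
  p.1 < n -> p.2 < 3 -> q.1 < n -> q.2 < 3 -> grid_adj p q ->
  exists z : nat * nat, [/\ z.1 < n, z.2 < 3 &
    [/\ grid_adj z p, z <> q &
        forall v, grid_adj v q -> grid_adj z v -> v = p]
    \/
    [/\ grid_adj z q, z <> p &
        forall v, grid_adj v p -> grid_adj z v -> v = q]].
Proof.
case: p q => [x y] [x' y'] /= n3 px py qx qy; rewrite /grid_adj /= => adj.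
have [h|h] : (x + x < n + x' /\ y + y < 3 + y' /\ x' <= x + x /\ y' <= y + y) \/
  (x' + x' < n + x /\ y' + y' < 3 + y /\ x <= x' + x' /\ y <= y' + y') by lia.
  exists (x + x - x', y + y - y'); split=> /=; [lia|lia|left; split].
  - lia.
  - by case=> ? ?; lia.
  - by move=> [u v] /= ? ?; congr (_, _); lia.
exists (x' + x' - x, y' + y' - y); split=> /=; [lia|lia|right; split].
- lia.
- by case=> ? ?; lia.
- by move=> [u v] /= ? ?; congr (_, _); lia.
Qed.

(** This forces [x = 3] and [y = 2]; it makes a path of length 3 between nonadjacent vertices of
    opposite parity a geodesic. *)
Lemma odd_leq3 x y : odd x -> x <> 1 -> x <= y.+1 -> y <= 2 -> 1 + y = x.
Proof. by lia. Qed.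

Section Strong.
Variables (n : nat) (D : rel ('I_n * 'I_3)).
Variable d : 'I_n * 'I_3 -> 'I_n * 'I_3 -> nat.
Implicit Types (S : {set 'I_n * 'I_3}) (u v w : 'I_n * 'I_3).
Hypothesis n3 : 3 <= n.
Hypothesis oD : orientation (cart_prod (path_graph n) (path_graph 3)) D.
Hypothesis dD : is_dist D d.

Let pos u : nat * nat := (val u.1, val u.2).
Let adj u v := grid_adj (pos u) (pos v).

Lemma pos_inj : injective pos.
Proof.
by move=> [i j] [i' j'] [/val_inj-> /val_inj->].
Qed.

Lemma adjP u v : adj u v = D u v || D v u.
Proof. by case: (oD u v) => ->. Qed.

Lemma arc_adj u v : D u v -> adj u v.
Proof. by rewrite adjP => ->. Qed.

Lemma arc_asym u v : D u v -> ~~ D v u.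
Proof. by move=> uv; case: (oD u v) => _; rewrite uv. Qed.

Lemma arc_neq u v : D u v -> u <> v.
Proof. by move=> uv e; have := arc_asym uv; rewrite {1}e -{1}e uv. Qed.

Lemma dist_odd u v :
  odd (d u v) = odd ((pos u).1 + (pos u).2) (+) odd ((pos v).1 + (pos v).2).
Proof.
move: {2}(d u v) (erefl (d u v)) => k; elim: k u => [|k IH] u duv.
  by rewrite duv (dist_eq0 dD duv) addbb.
have nuv : u <> v by move=> e; rewrite e (dist0 dD) in duv.
have [w uw dw] := dist_first dD nuv.
rewrite dw /= IH; last lia.
by rewrite (grid_adj_odd (arc_adj uw)) addNb negbK.
Qed.

Lemma exists_other u : exists v, u <> v.
Proof.
have n0 : 0 < n by lia.
have [e|/eqP ne] := eqVneq u (Ordinal n0, ord0); last by eexists; apply: ne.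
by exists (Ordinal n0, ord_max); rewrite e; case.
Qed.

Lemma exists_out u : exists v, D u v.
Proof.
have [v nuv] := exists_other u.
by have [w uw _] := dist_first dD nuv; exists w.
Qed.

Lemma exists_in u : exists v, D v u.
Proof.
have [v nuv] := exists_other u.
by have [w uw _] := dist_last dD (nesym nuv); exists w.
Qed.

(** The vertices [u] and [v] have the same parity, so no arc joins them, and they differ by
    antisymmetry; the path through [w] is a geodesic. *)
Lemma closed_between S u w v : geo_closed d S -> D u w -> D w v ->
  u \in S -> v \in S -> w \in S.
Proof.
move=> cS uw wv uS vS; apply: (closed_path2 dD cS uS vS uw wv).
  by move=> e; have := arc_asym uw; rewrite e wv.
apply/negP => /arc_adj/grid_adj_odd.
have := grid_adj_odd (arc_adj uw); have := grid_adj_odd (arc_adj wv).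
by move=> -> ->; rewrite negbK; case: odd.
Qed.

(** A vertex outside [S] never has both an in-neighbour and an out-neighbour in [S]. So a complement
    of at most two vertices is an arc from [w1] to [w2], where all other neighbours of [w1] point to
    it and all other neighbours of [w2] are pointed to. *)
Lemma card_complement_closed S : geo_closed d S -> S <> [set: _]%SET ->
  3 <= #|~: S|.
Proof.
move=> cS nS.
have out w : w \notin S -> forall u v, D u w -> D w v ->
    (u \notin S) || (v \notin S).
  move=> wS u v uw wv; rewrite -negb_and; apply: contra wS => /andP[uS vS].
  exact: closed_between uw wv uS vS.
rewrite ltnNge; apply/negP => le2.
have [w1 w1S] : exists w, w \notin S.
  apply/existsP; rewrite -negb_forall; apply/negP => /forallP full.
  by apply: nS; apply/setP => x; rewrite finset.in_setT full.
have nbr w : w \notin S ->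
    exists w', [/\ w' \notin S, w' <> w & D w w' || D w' w].
  move=> wS; have [u uw] := exists_in w; have [v wv] := exists_out w.
  have /orP[uS|vS] := out w wS u v uw wv.
    by exists u; rewrite uw orbT; split=> //; apply: arc_neq uw.
  by exists v; rewrite wv; split=> //; apply/nesym/(arc_neq wv).
have [w2 [w2S n12 a12]] := nbr w1 w1S.
have others u : u <> w1 -> u <> w2 -> u \in S.
  move=> nu1 nu2; apply/negPn/negP => uS; move: le2; apply/negP.
  rewrite -ltnNge.
  have sub : (u |: [set w1; w2])%SET \subset ~: S.
    by apply/fintype.subsetP => x; rewrite !finset.inE => /or3P[]/eqP->.
  apply: leq_trans (subset_leq_card sub).
  rewrite cardsU1 cards2 !finset.inE.
  by move/eqP/negPf: nu1 => ->; move/eqP/negPf: nu2 => ->;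
    move/eqP: n12; rewrite eq_sym => ->.
wlog a : w1 w2 w1S w2S n12 others {a12} / D w1 w2.
  move=> main; case/orP: a12 => a; first exact: (main w1 w2).
  apply: (main w2 w1) => //; first exact: nesym.
  by move=> u ? ?; apply: others.
have into u : adj u w1 -> u <> w2 -> D u w1 /\ u \in S.
  move=> adj1 nu2.
  have nu1 : u <> w1 by move=> e; move: adj1; rewrite e /adj /grid_adj; lia.
  have uS := others u nu1 nu2; split=> //.
  have [v vw1] := exists_in w1.
  have nv2 : v <> w2 by move=> e; have := arc_asym a; rewrite -e vw1.
  have vS := others v (arc_neq vw1) nv2.
  move: adj1; rewrite adjP => /orP[//|w1u].
  by have := out w1 w1S v u vw1 w1u; rewrite vS uS.
have from v : adj v w2 -> v <> w1 -> D w2 v /\ v \in S.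
  move=> adj2 nv1.
  have nv2 : v <> w2 by move=> e; move: adj2; rewrite e /adj /grid_adj; lia.
  have vS := others v nv1 nv2; split=> //.
  have [u w2u] := exists_out w2.
  have nu1 : u <> w1 by move=> e; have := arc_asym a; rewrite -e w2u.
  have uS := others u nu1 (nesym (arc_neq w2u)).
  move: adj2; rewrite adjP => /orP[vw2|//].
  by have := out w2 w2S v u vw2 w2u; rewrite vS uS.
(* If [u] and [v] were not adjacent, their distance would be 3 by parity, and the path through [w1]
   and [w2] would be a geodesic. *)
have square u v : adj u w1 -> u <> w2 -> adj v w2 -> v <> w1 -> adj u v.
  move=> u1 u2 v2 v1; have [uw1 uS] := into u u1 u2.
  have [w2v vS] := from v v2 v1.
  apply: contraNT w1S => nadj.
  apply: (cS u v w1 uS vS).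
  have nD : d u v <> 1.
    have [<-|/eqP nuv] := eqVneq u v; first by rewrite (dist0 dD).
    have [w uw ->] := dist_first dD nuv => -[/(dist_eq0 dD) e].
    by move: nadj; rewrite adjP -e uw.
  rewrite (dist_arc dD uw1 (arc_neq uw1)); apply: odd_leq3 nD _ _.
  - rewrite dist_odd (grid_adj_odd (arc_adj w2v)) (grid_adj_odd (arc_adj a)).
    by rewrite (grid_adj_odd (arc_adj uw1)) negbK addbN addbb.
  - exact: (dist_step dD).
  - by rewrite -(dist_arc dD w2v (arc_neq w2v)); apply: (dist_step dD).
have [u0 u0w1] := exists_in w1; have [v0 w2v0] := exists_out w2.
have u02 : u0 <> w2 by move=> e; have := arc_asym a; rewrite -e u0w1.
have v01 : v0 <> w1 by move=> e; have := arc_asym a; rewrite -e w2v0.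
have [[x y] [/= xn y3 zP]] := @grid_extend n (pos w1) (pos w2) n3
  (ltn_ord _) (ltn_ord _) (ltn_ord _) (ltn_ord _) (arc_adj a).
pose z : 'I_n * 'I_3 := (Ordinal xn, Ordinal y3).
have zE : pos z = (x, y) by [].
rewrite -zE in zP.
(* The straight extension [z] of the edge is not adjacent to any further neighbour of the opposite
   end, against [square]. *)
case: zP => -[adjz nz uniq].
- apply: (v01); apply: pos_inj; apply: uniq.
    by rewrite grid_adj_sym; apply: arc_adj.
  apply: square => //; first by move=> e; apply: nz; rewrite e.
  by rewrite /adj grid_adj_sym; apply: arc_adj.
- apply: (u02); apply: pos_inj; apply: uniq; first exact: arc_adj.
  rewrite grid_adj_sym; apply: square => //; first exact: arc_adj.
  by move=> e; apply: nz; rewrite e.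
Qed.

End Strong.

(** * Small vertex sets of minimum degree two *)

Fixpoint forall_bits n (P : bitseq -> bool) : bool :=
  if n is n'.+1 then
    forall_bits n' (fun s => P (true :: s)) &&
    forall_bits n' (fun s => P (false :: s))
  else P [::].

Lemma forall_bitsP (P : bitseq -> bool) s : forall_bits (size s) P -> P s.
Proof.
by elim: s P => //= b s IH P /andP[/IH Pt /IH Pf]; case: b.
Qed.

(* [x_i] is row [x] of the [i]-th of three consecutive columns; the hypotheses
   say that every chosen cell has two chosen neighbours. *)
Lemma three_columns (a1 b1 c1 a2 b2 c2 a3 b3 c3 : bool) :
  let cells := a1 + b1 + c1 + (a2 + b2 + c2) + (a3 + b3 + c3) in
  (a1 -> 2 <= a2 + b1) -> (b1 -> 2 <= b2 + c1 + a1) -> (c1 -> 2 <= c2 + b1) ->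
  (a2 -> 2 <= a1 + a3 + b2) -> (b2 -> 2 <= b1 + b3 + c2 + a2) ->
  (c2 -> 2 <= c1 + c3 + b2) ->
  (a3 -> 2 <= a2 + b3) -> (b3 -> 2 <= b2 + c3 + a3) -> (c3 -> 2 <= c2 + b3) ->
  0 < cells < 8 ->
  [|| cells == 4, cells == 6 |
   [&& cells == 7, [&& a2, b2 & c2], ~~ [&& a1, b1 & c1],
       ~~ [&& a3, b3 & c3] & [|| a3, b3 | c3]]].
Proof.
move=> cells /implyP h1 /implyP h2 /implyP h3 /implyP h4 /implyP h5 /implyP h6
  /implyP h7 /implyP h8 /implyP h9 h10.
(* The claim as a boolean function of nine bits, so that all 512 patterns are checked by
   computation. *)
pose good (s : bitseq) := if s is [:: a1; b1; c1; a2; b2; c2; a3; b3; c3] then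
  let cells := a1 + b1 + c1 + (a2 + b2 + c2) + (a3 + b3 + c3) in
  [&& a1 ==> (2 <= a2 + b1), b1 ==> (2 <= b2 + c1 + a1),
  c1 ==> (2 <= c2 + b1), a2 ==> (2 <= a1 + a3 + b2),
  b2 ==> (2 <= b1 + b3 + c2 + a2), c2 ==> (2 <= c1 + c3 + b2),
  a3 ==> (2 <= a2 + b3), b3 ==> (2 <= b2 + c3 + a3), c3 ==> (2 <= c2 + b3) &
  0 < cells < 8] ==> [|| cells == 4, cells == 6 |
   [&& cells == 7, [&& a2, b2 & c2], ~~ [&& a1, b1 & c1],
       ~~ [&& a3, b3 & c3] & [|| a3, b3 | c3]]] else true.
have /implyP : good [:: a1; b1; c1; a2; b2; c2; a3; b3; c3].
  by apply: forall_bitsP; vm_compute.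
by apply; rewrite h1 h2 h3 h4 h5 h6 h7 h8 h9 h10.
Qed.

(** Beyond the first column nothing is chosen, so each end of a vertical run in it needs its one
    vertical neighbour and its neighbour in the second column. *)
Lemma two_columns (a1 b1 c1 a2 b2 c2 : bool) :
  [|| a1, b1 | c1] ->
  (a1 -> 2 <= a2 + b1) -> (b1 -> 2 <= b2 + c1 + a1) -> (c1 -> 2 <= c2 + b1) ->
  (2 <= a1 + b1 + c1) && (2 <= a2 + b2 + c2).
Proof.
move=> ne /implyP h1 /implyP h2 /implyP h3.
suff: [&& [|| a1, b1 | c1], a1 ==> (2 <= a2 + b1), b1 ==> (2 <= b2 + c1 + a1) &
  c1 ==> (2 <= c2 + b1)] ==> (2 <= a1 + b1 + c1) && (2 <= a2 + b2 + c2).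
  by move/implyP; apply; rewrite ne h1 h2 h3.
by case: a1 {ne h1 h2 h3}; case: b1; case: c1; case: a2; case: b2; case: c2.
Qed.

Lemma two_directions (i j x y x' y' : nat) (l r t b : bool) :
  x <> x' \/ y <> y' ->
  [\/ x = i - 1 /\ y = j /\ l = true, x = i + 1 /\ y = j /\ r = true,
      x = i /\ y = j + 1 /\ t = true |
      x = i /\ y = j - 1 /\ (0 < j) && b = true] ->
  [\/ x' = i - 1 /\ y' = j /\ l = true, x' = i + 1 /\ y' = j /\ r = true,
      x' = i /\ y' = j + 1 /\ t = true |
      x' = i /\ y' = j - 1 /\ (0 < j) && b = true] ->
  2 <= l + r + t + (0 < j) * b.
Proof.
move=> ne [] [e1 [e2 e3]] [] [e4 [e5 e6]]; case: ne => ne; subst;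
  rewrite ?muln1 //; by [case: ne | lia].
Qed.

Section MinDegree.
Variables (n : nat) (S : {set 'I_n * 'I_3}).
Let adj := cart_prod (path_graph n) (path_graph 3).
Hypothesis deg2 : forall u, u \in S ->
  exists v w, [/\ v \in S, w \in S, v <> w, adj u v & adj u w].

(* Columns are shifted by one so that column [0] is empty. *)
Let A (j i : nat) : bool :=
  [exists u in S, ((val u.1).+1 == i) && (val u.2 == j)].

Lemma cellP u i j : (val u.1).+1 = i -> val u.2 = j -> A j i = (u \in S).
Proof.
move=> ui uj; apply/exists_inP/idP => [[v vS /andP[/eqP vi /eqP vj]]|uS].
  suff -> : u = v by [].
  case: u v ui uj vi vj {vS} => [x y] [x' y'] /= <- <- [ex] ey.
  by congr (_, _); apply: val_inj.
by exists u; rewrite // ui uj !eqxx.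
Qed.

Lemma cell_bound j i : A j i -> 0 < i <= n.
Proof. by case/exists_inP=> u _ /andP[/eqP<- _]; rewrite ltn_ord. Qed.

Lemma cell_row j i : A j i -> j < 3.
Proof. by case/exists_inP=> u _ /andP[_ /eqP<-]; rewrite ltn_ord. Qed.

(** The factor [0 < j] guards row 0, where [j.-1] would denote the cell itself. *)
Lemma cell_deg2 j i : A j i.+1 ->
  2 <= A j i + A j i.+2 + A j.+1 i.+1 + (0 < j) * A j.-1 i.+1.
Proof.
case/exists_inP=> u uS /andP[/eqP [ui] /eqP uj].
have [v [w [vS wS nvw uv uw]]] := deg2 uS.
have cell x i' j' :
    x \in S -> (val x.1).+1 = i' -> val x.2 = j' -> A j' i' = true.
  by move=> xS e1 e2; rewrite (cellP e1 e2).
have nbr x : x \in S -> adj u x -> [\/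
    (x.1 : nat) = i - 1 /\ (x.2 : nat) = j /\ A j i = true,
    (x.1 : nat) = i + 1 /\ (x.2 : nat) = j /\ A j i.+2 = true,
    (x.1 : nat) = i /\ (x.2 : nat) = j + 1 /\ A j.+1 i.+1 = true |
    (x.1 : nat) = i /\ (x.2 : nat) = j - 1 /\ (0 < j) && A j.-1 i.+1 = true].
  move=> xS; rewrite /adj grid_adjE /grid_adj /= ui uj.
  case/orP=> /andP[/eqP e /orP[]/eqP e'].
  - apply: Or43; do !split; [lia|lia|].
    by apply: (cell x) => //=; lia.
  - apply: Or44; do !split; [lia|lia|].
    by rewrite (cell x _ _ xS) /=; lia.
  - apply: Or42; do !split; [lia|lia|].
    by apply: (cell x) => //=; lia.
  - apply: Or41; do !split; [lia|lia|].
    by apply: (cell x) => //=; lia.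
have nE : v.1 <> w.1 :> nat \/ v.2 <> w.2 :> nat.
  have [e1|/eqP] := eqVneq (v.1 : nat) w.1; last by left.
  have [e2|/eqP] := eqVneq (v.2 : nat) w.2; last by right.
  case: nvw; case: (v) (w) e1 e2 => [? ?] [? ?] /= e1 e2.
  by congr (_, _); apply: val_inj.
exact: two_directions nE (nbr v vS uv) (nbr w wS uw).
Qed.

Let F i := A 0 i + A 1 i + A 2 i.

Lemma column_out i : i = 0 \/ n < i -> F i = 0.
Proof.
have A0 j : i = 0 \/ n < i -> A j i = false.
  by move=> hi; case Aji: (A j i) => //; have := cell_bound Aji; lia.
by move=> hi; rewrite /F !A0.
Qed.

(** Three empty columns past the last one are included, so that windows starting at a nonempty
    column stay in range. *)
Lemma card_columns : #|S| = \sum_(0 <= i < n.+4) F i.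
Proof.
rewrite (big_cat_nat (n := n.+1)) //=; last lia.
rewrite [X in _ + X]big_nat_cond [X in _ + X]big1 ?addn0; last first.
  by move=> i /andP[/andP[ni _] _]; apply: column_out; right.
rewrite big_ltn // column_out ?add0n; last by left.
rewrite big_add1 /= big_mkord -sum1_card big_mkcond /=.
transitivity (\sum_i \sum_j (((i, j) : 'I_n * 'I_3) \in S : nat)).
  rewrite (pair_bigA _ (fun i j => ((i, j) : 'I_n * 'I_3) \in S : nat)) /=.
  by apply: eq_bigr => -[i j] _ /=; case: ifP.
apply: eq_bigr => i _; rewrite !big_ord_recr big_ord0 /= add0n.
by rewrite -!(@cellP (_, _) _ _ (erefl _) (erefl _)).
Qed.

Lemma sum_four i k (G : nat -> nat) m : i.+2 <= k -> k.+2 <= m ->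
  G i + G i.+1 + (G k + G k.+1) <= \sum_(0 <= l < m) G l.
Proof.
move=> ik km; rewrite (big_cat_nat (n := k)) //=; last lia.
rewrite (big_cat_nat (n := i) (p := k)) //=; last lia.
rewrite (big_ltn (m := i)); last lia.
rewrite (big_ltn (m := i.+1)); last lia.
rewrite (big_ltn (m := k)); last lia.
rewrite (big_ltn (m := k.+1)); last lia.
rewrite /=.
by lia.
Qed.

Lemma column_eq0 j i : j < 3 -> F i = 0 -> A j i = false.
Proof.
by move=> j3; rewrite /F; case: j j3 => [|[|[|//]]] _; do 3!case: (A _ _).
Qed.

Lemma column_deg2 i : [|| A 0 i.+1, A 1 i.+1 | A 2 i.+1] ->
  (F i = 0 -> (2 <= F i.+1) && (2 <= F i.+2)) /\
  (F i.+2 = 0 -> (2 <= F i.+1) && (2 <= F i)).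
Proof.
have A3 : A 3 i.+1 = false by case e: (A 3 i.+1) => //; have := cell_row e.
have := @cell_deg2 0 i; have := @cell_deg2 1 i; have := @cell_deg2 2 i.
rewrite A3 /= mul0n !mul1n !addn0 => h2 h1 h0 ne.
by split=> F0; apply: two_columns => //; move: h0 h1 h2;
  rewrite !(column_eq0 _ F0) // ?add0n ?addn0.
Qed.

(** The set fits into three consecutive columns, where the patterns are enumerated. At size 7 the
    middle column is full and a vertex is missing on each side of it. *)
Lemma small_deg2 : 0 < #|S| < 8 ->
  [\/ #|S| = 4, #|S| = 6 | #|S| = 7 /\ exists k,
    [/\ forall u : 'I_n * 'I_3, u.1 = k :> nat -> u \in S,
        exists2 x : 'I_n * 'I_3, x \notin S & x.1 < k &
        exists2 y : 'I_n * 'I_3, y \notin S & k < y.1]].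
Proof.
move=> cardS; pose P i := [|| A 0 i.+1, A 1 i.+1 | A 2 i.+1].
have PE i : P i = (F i.+1 != 0) by rewrite /P /F; do 3!case: (A _ _).
have [u uS] : exists u, u \in S by apply/card_gt0P; lia.
have exP : exists i, P i.
  exists u.1; move: (uS); rewrite -(@cellP u _ _ erefl erefl) /P.
  by case: (u.2) => [[|[|[|//]]] j] /= ->; rewrite ?orbT.
have leP i : P i -> i <= n by case/or3P=> /cell_bound; lia.
have [i0 Pi0 min] := ex_minnP exP; have [j0 Pj0 max] := ex_maxnP exP leP.
have Fle i : i <= i0 -> F i = 0.
  case: i => [|i] ii0; first by apply: column_out; left.
  by apply/eqP/negPn; rewrite -PE; apply/negP => /min; lia.
have Fgt i : j0.+1 < i -> F i = 0.
  case: i => [//|i] ij0.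
  by apply/eqP/negPn; rewrite -PE; apply/negP => /max; lia.
have [ci0 _] := column_deg2 Pi0; have [_ cj0] := column_deg2 Pj0.
have /andP[f1 f2] := ci0 (Fle _ (leqnn _)).
have /andP[f3 f4] := cj0 (Fgt _ (leqnn _)).
(* The first two and the last two nonempty columns hold at least two cells each; four distinct such
   columns would give 8 cells. *)
have ij0 : j0 <= i0.+2.
  rewrite leqNgt; apply/negP => lt.
  have j0n := leP _ Pj0.
  have := @sum_four i0.+1 j0 F n.+4; rewrite -card_columns; lia.
have cardE : #|S| = F i0.+1 + F i0.+2 + F i0.+3.
  have i0n := leP _ Pi0; rewrite card_columns.
  rewrite (big_cat_nat (n := i0.+1)) //=; last lia.
  rewrite big_nat_cond big1 ?add0n; last first.
    by move=> i /andP[/andP[_ ii0] _]; apply: Fle.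
  rewrite (big_ltn (m := i0.+1)); last lia.
  rewrite (big_ltn (m := i0.+2)); last lia.
  rewrite (big_ltn (m := i0.+3)); last lia.
  rewrite [\sum_(i0.+4 <= _ < _) _]big_nat_cond big1 ?addn0 ?addnA // => i.
  by move=> /andP[/andP[ii0 _] _]; apply: Fgt; lia.
have A3 i : A 3 i = false by case e: (A 3 i) => //; have := cell_row e.
have z0 j : j < 3 -> A j i0 = false.
  by move=> j3; apply: column_eq0 => //; apply: Fle.
have z4 j : j < 3 -> A j i0.+4 = false.
  by move=> j3; apply: column_eq0 => //; apply: Fgt; lia.
have := @three_columns (A 0 i0.+1) (A 1 i0.+1) (A 2 i0.+1)
  (A 0 i0.+2) (A 1 i0.+2) (A 2 i0.+2) (A 0 i0.+3) (A 1 i0.+3) (A 2 i0.+3).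
have := @cell_deg2 0 i0; have := @cell_deg2 1 i0; have := @cell_deg2 2 i0.
have := @cell_deg2 0 i0.+1; have := @cell_deg2 1 i0.+1.
have := @cell_deg2 2 i0.+1; have := @cell_deg2 0 i0.+2.
have := @cell_deg2 1 i0.+2; have := @cell_deg2 2 i0.+2.
rewrite !A3 !z0 // !z4 //= !mul0n !mul1n !add0n !addn0 -!/(F _) -cardE.
move=> d1 d2 d3 d4 d5 d6 d7 d8 d9 /(_ d9 d8 d7 d6 d5 d4 d3 d2 d1 cardS).
case/or3P=> [/eqP|/eqP|/and5P[/eqP card7 full n1 n3 some3]];
  [exact: Or31|exact: Or32|apply: Or33].
have [/and3P[fa fb fc] i02n] :
    [&& A 0 i0.+2, A 1 i0.+2 & A 2 i0.+2] /\ i0.+2 < n.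
  by split=> //; case/or3P: some3 => /cell_bound /andP[].
have find i : i < n -> ~~ [&& A 0 i.+1, A 1 i.+1 & A 2 i.+1] ->
    exists2 x : 'I_n * 'I_3, x \notin S & x.1 = i :> nat.
  move=> lin nfull.
  have [j nj] : exists j : 'I_3, ~~ A j i.+1.
    apply/existsP; rewrite -negb_forall; apply: contra nfull => /forallP full'.
    by rewrite (full' ord0) (full' (lift ord0 ord0)) (full' ord_max).
  exists (Ordinal lin, j) => //; move: nj.
  by rewrite (@cellP (Ordinal lin, j) _ _ erefl erefl).
(* The middle column has shifted index [i0.+2], hence index [i0.+1] in the grid. *)
split=> //; exists i0.+1; split.
- move=> v vi; have <- : A v.2 i0.+2 = (v \in S).
    by apply: cellP; rewrite //= vi.
  by have := ltn_ord v.2; case: (v.2 : nat) => [|[|[|]]].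
- have [x xS xi] := find i0 (ltnW (ltnW i02n)) n1.
  by exists x => //; rewrite xi.
- have [x xS xi] := find i0.+2 i02n n3.
  by exists x => //; rewrite xi.
Qed.

End MinDegree.

(** * Bounds on the convexity number and the spectrum *)

Lemma con_attained (T : finType) (D : rel T) d : is_dist D d -> 1 < #|T| ->
  exists S : {set T},
  [/\ geo_closed d S, 0 < #|S|, S <> [set: T]%SET & #|S| = con D].
Proof.
move=> dD T1; have [x _] : exists x, x \in T by apply/card_gt0P; apply: ltnW T1.
pose P (S : {set T}) := `[< convex D S >] && (S != [set: T]%SET).
have [|S /andP[/asboolP/(convexP dD)[S0 cS] /eqP nS] conE] :=
    @eq_bigmax_cond _ P (fun S : {set T} => #|S|).
  apply/card_gt0P; exists [set x]%SET; apply/andP; split.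
    apply/asboolP/(convexP dD); split.
      by apply/set0Pn; exists x; rewrite finset.inE.
    move=> u v w; rewrite !finset.inE => /eqP-> /eqP->.
    rewrite (dist0 dD) => e; apply/eqP/esym/(dist_eq0 dD); lia.
  by apply/eqP => e; move: T1; rewrite -cardsT -e cards1.
by exists S; split=> //; rewrite card_gt0.
Qed.

Lemma closed_leq_con (T : finType) (D : rel T) d (S : {set T}) :
  is_dist D d -> geo_closed d S -> 0 < #|S| -> S <> [set: T]%SET ->
  #|S| <= con D.
Proof.
move=> dD cS S0 nS; apply: (@leq_bigmax_cond _ _ (fun X : {set T} => #|X|) S).
apply/andP; split; last exact/eqP.
by apply/asboolP/(convexP dD); rewrite -card_gt0.
Qed.

Lemma grid_adj_far k p q : p.1 < k < q.1 -> grid_adj p q = false.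
Proof. by rewrite /grid_adj; lia. Qed.

Lemma con_grid n (D : rel ('I_n * 'I_3)) : 3 <= n ->
  orientation (cart_prod (path_graph n) (path_graph 3)) D -> strong D ->
  1 <= con D <= 3 * n - 3 /\
  (con D < 8 -> [\/ con D = 1, con D = 4 | con D = 6]).
Proof.
move=> n3 oD /strong_dist[d dD].
have cardT : #|{: 'I_n * 'I_3}| = 3 * n by rewrite card_prod !card_ord mulnC.
have [|S [cS S0 nS cardS]] := con_attained dD; first by rewrite cardT; lia.
rewrite -cardS; split.
  have := card_complement_closed n3 oD dD cS nS.
  have e : #|S| + #|~: S| = 3 * n by rewrite cardsC cardT.
  by rewrite -(leq_add2l #|S|) e; move: S0; case: #|S| => // m; lia.
move=> S8; have [S1|S1] := leqP #|S| 1; first by apply: Or31; lia.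
(* Geodesics from [u] to another vertex of [S] and back give an out-neighbour and an in-neighbour in
   [S], distinct by antisymmetry. *)
have deg2 u : u \in S -> exists v w, [/\ v \in S, w \in S, v <> w,
    cart_prod (path_graph n) (path_graph 3) u v &
    cart_prod (path_graph n) (path_graph 3) u w].
  move=> uS; have [x xS nux] : exists2 x, x \in S & u <> x.
    have /card_gt1P[x [y [xS yS nxy]]] := S1.
    have [ux|/eqP nux] := eqVneq u x; last by exists x.
    by exists y => //; rewrite ux; apply/eqP.
  have [v vS uv] := closed_out dD cS uS xS nux.
  have [w wS wu] := closed_out (is_dist_converse dD)
    (proj2 (closed_converse d S) cS) uS xS nux.
  exists v, w; rewrite -!(proj1 (oD _ _)) uv; split=> //.
    by move=> vw; move: wu; rewrite -vw; apply/negP/(arc_asym oD uv).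
  by rewrite orbC (wu : D w u).
have [|S4|S6|[S7 [k [full [x xS xk] [y yS ky]]]]] := small_deg2 deg2.
- by rewrite S0 S8.
- exact: Or32.
- exact: Or33.
(* The full column [k] separates [R] from the missing vertices on its left. Thus [~: R] is closed,
   larger than [S] because of [x], and proper because of [y]. *)
pose R := [set u : 'I_n * 'I_3 | (u \notin S) && (k < u.1)]%SET.
have cR : geo_closed d (~: R).
  apply: (closed_component dD cS).
    rewrite -setI_eq0; apply/eqP/setP => u; rewrite !finset.inE.
    by case: (u \in S).
  move=> u v; rewrite !finset.inE => uSR /andP[vS kv].
  have [uS nku] : u \notin S /\ u.1 <= k.
    by move: uSR; case: (u \in S) => //=; rewrite -leqNgt.
  have nuk : u.1 <> k :> nat by move=> uk; rewrite full in uS.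
  rewrite -negb_or (proj1 (oD u v)) grid_adjE.
  by rewrite (@grid_adj_far k) //= kv ltn_neqAle nku; move/eqP: nuk => ->.
have sub : S \subset ~: R.
  by apply/fintype.subsetP => u uS; rewrite !finset.inE uS.
have xR : x \in ~: R by rewrite !finset.inE xS -leqNgt ltnW.
have lt : #|S| < #|~: R|.
  apply: proper_card; rewrite finset.properEneq sub andbT.
  by apply/eqP => e; rewrite e xR in xS.
have yR : y \in R by rewrite finset.inE yS ky.
have : #|~: R| <= con D; last by rewrite leqNgt -cardS lt.
apply: (closed_leq_con dD cR); first exact: leq_ltn_trans lt.
by move=> e; have := finset.in_setT y; rewrite -e finset.in_setC yR.
Qed.

Theorem theorem15 (n : nat) (hn : 3 <= n) :
  strong_convexity_spectrum (cart_prod (path_graph n) (path_graph 3)) =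
  ([set r : nat | 1 <= r <= 3 * n - 3] `\` [set 2; 3; 5; 7])%classic.
Proof.
apply/seteqP; split=> r.
  move=> [D [oD sD] <-]; have [bnd small] := con_grid hn oD sD.
  by split=> //= -[[[]|]|] e; case: small; rewrite ?e.
move=> [/= bnd excl].
have [||||l [h real]] := @realizable_all n r hn bnd;
  last exact: realizable_spectrum real.
all: by move=> e; apply: excl; rewrite e /=; tauto.
Qed.
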